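(* Let $(\Omega,\Sigma,\mu)$ be a complete, strictly localizable measure space, let $p\in[1,\infty]$, and let $F$ be a real Banach lattice. Let $T\in\mathscr{L}(L^p(\Omega;F'))$ be a local operator and let $M\in L^\infty_{\sigma^\ast}(\Omega;\mathscr{L}(F'))$ be such that $T=\mathcal{M}_M$, i.e. (for a suitable representative of $M$) for every $f\in L^p(\Omega;F')$ one has $(Tf)(\omega)=M(\omega)f(\omega)$ for almost every $\omega\in\Omega$. Then $T$ is positive if and only if $M$ is positive.
   Context: **Local operators.** $T\in\mathscr{L}(L^p(\Omega;F'))$ is local if for all $f\in L^p(\Omega;F')$ one has $Tf=0$ almost everywhere on $\{\omega:f(\omega)=0\}$. $L^p(\Omega;F')$ is the Bochner space of strongly measurable (i.e. weakly measurable and almost separably valued) functions. **Multipliers.** For a Banach space $G$ with closed unit ball $B_G$, $\mathcal{L}_{\sigma^\ast}(\Omega;G')$ is the space of functions $f\colon\Omega\to G'$ such that $\omega\mapsto\langle f(\omega),v\rangle$ is measurable for every $v\in G$ and $\|f\|_{\sigma^\ast}:=\sup_{v\in B_G}\operatorname{ess\,sup}_{\omega\in\Omega}|\langle f(\omega),v\rangle|<\infty$; $L^\infty_{\sigma^\ast}(\Omega;G')$ is its quotient by $\{f:\|f\|_{\sigma^\ast}=0\}$. Here $\mathscr{L}(F')$ is regarded as the dual of the projective tensor product $F'\tilde\otimes_\pi F$ via $\langle S,v'\otimes v\rangle=\langle Sv',v\rangle_{F',F}$, and $L^\infty_{\sigma^\ast}(\Omega;\mathscr{L}(F'))$ is formed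 with respect to this predual. $(\mathcal{M}_Mf)(\omega):=M(\omega)f(\omega)$. (For every local $T$ such an $M$ exists.) **Order.** $f\in L^p(\Omega;F')$ is positive if $f(\omega)\in F'_+$ for almost every $\omega$; $T$ is positive if it maps positive elements to positive elements. $M\in L^\infty_{\sigma^\ast}(\Omega;\mathscr{L}(F'))$ is positive if it has a representative taking values only in the positive operators on $F'$. **Measure theory.** $(\Omega,\Sigma,\mu)$ is strictly localizable if there is a partition $(A_\alpha)_{\alpha\in I}$ of $\Omega$ into measurable sets of finite measure such that $B\subset\Omega$ is in $\Sigma$ if and only if $B\cap A_\alpha\in\Sigma$ for all $\alpha$, and $\mu(B)=\sum_\alpha\mu(B\cap A_\alpha)$ for $B\in\Sigma$. *)

(* Defs.v *)
From HB Require Import structures.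
From mathcomp Require Import all_boot all_order all_algebra.
From mathcomp Require Import all_classical all_reals all_analysis.

Set Implicit Arguments.
Unset Strict Implicit.
Unset Printing Implicit Defensive.

Import Order.TTheory GRing.Theory Num.Theory.
Import numFieldNormedType.Exports.

Local Open Scope classical_set_scope.
Local Open Scope ring_scope.

(* Real Banach lattices.  A plain record over the normed space rather than a
   join with the structures of order.v: HB refuses that join because
   [numDomainType] already inherits from both sides.  [bl_join x (- x)] is the
   modulus of [x], whereas [`|x|] is its norm. *)
Record banachLattice (R : realType) := BanachLattice {
  bl_space :> completeNormedModType R ;
  bl_le : bl_space -> bl_space -> Prop ;
  bl_join : bl_space -> bl_space -> bl_space ;
  bl_meet : bl_space -> bl_space -> bl_space ;
  bl_le_refl : forall x, bl_le x x ;
  bl_le_anti : forall x y, bl_le x y -> bl_le y x -> x = y ;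
  bl_le_trans : forall y x z, bl_le x y -> bl_le y z -> bl_le x z ;
  bl_joinP : forall x y z, bl_le (bl_join x y) z <-> bl_le x z /\ bl_le y z ;
  bl_meetP : forall x y z, bl_le z (bl_meet x y) <-> bl_le z x /\ bl_le z y ;
  bl_leD2r : forall z x y, bl_le x y -> bl_le (x + z) (y + z) ;
  bl_scale_ge0 : forall (a : R) x, 0 <= a -> bl_le 0 x -> bl_le 0 (a *: x) ;
  bl_le_norm : forall x y,
    bl_le (bl_join x (- x)) (bl_join y (- y)) -> `|x| <= `|y| }.

(* The normed space of bounded linear operators, with the operator norm. *)
Section BoundedOperators.
Variables (R : realType) (V W : normedModType R).

Definition bounded_operator_pred : {pred V -> W} :=
  [pred f | `[< linear f /\ continuous f >]].

Record bounded_operator := BoundedOperator {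
  bop_fun :> V -> W ;
  bop_funP : bop_fun \in bounded_operator_pred }.

HB.instance Definition _ := [isSub for bop_fun].
HB.instance Definition _ := [Choice of bounded_operator by <:].

Lemma bop_linear (f : bounded_operator) : linear f.
Proof. by case: f => g /= /asboolP[]. Qed.

Lemma bop_continuous (f : bounded_operator) : continuous f.
Proof. by case: f => g /= /asboolP[]. Qed.

HB.instance Definition _ (f : bounded_operator) :=
  GRing.isLinear.Build R V W _ f (bop_linear f).

Fact bounded_operator_submod : submod_closed bounded_operator_pred.
Proof.
split=> [|a f g].
  apply/asboolP; split=> [b x y|x]; last exact: cvg_cst.
  have e : b *: (0 : W) + 0 = 0 by rewrite scaler0 addr0.
  exact/esym.
move=> /asboolP[lf cf] /asboolP[lg cg]; apply/asboolP; split=> [b x y|x].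
  have e : a *: f (b *: x + y) + g (b *: x + y) =
      b *: (a *: f x + g x) + (a *: f y + g y) :> W.
    by rewrite lf lg !scalerDr !scalerA [b * a]mulrC addrACA.
  exact: e.
apply: (@cvgD _ _ _ _ _ (fun z => a *: f z) g); last exact: cg.
by apply: cvgZr; exact: cf.
Qed.
HB.instance Definition _ :=
  GRing.isSubmodClosed.Build R (V -> W) bounded_operator_pred
    bounded_operator_submod.
HB.instance Definition _ :=
  [SubChoice_isSubLmodule of bounded_operator by <:].

Definition operator_norm (f : bounded_operator) : R :=
  sup [set `|f x| | x in [set x : V | `|x| <= 1]].

Lemma operator_norm_has_sup (f : bounded_operator) :
  has_sup [set `|f x| | x in [set x : V | `|x| <= 1]].
Proof.
split; first by exists `|f 0|, 0 => //=; rewrite normr0.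
have /bounded_funP/(_ 1)[C fC] :=
  (linear_bounded_continuous (f : {linear V -> W})).2 (@bop_continuous f).
by exists C => _ [x /= x1 <-]; exact: fC.
Qed.

Lemma operator_norm_ub (f : bounded_operator) x :
  `|x| <= 1 -> `|f x| <= operator_norm f.
Proof.
by move=> x1; apply: ub_le_sup; [case: (operator_norm_has_sup f)|exists x].
Qed.

Lemma operator_norm_le (f : bounded_operator) c :
  (forall x, `|x| <= 1 -> `|f x| <= c) -> operator_norm f <= c.
Proof.
move=> fc; apply: ge_sup; first by case: (operator_norm_has_sup f).
by move=> _ [x /= x1 <-]; exact: fc.
Qed.

Fact operator_norm_ler_normD f g :
  operator_norm (f + g) <= operator_norm f + operator_norm g.
Proof.
apply: operator_norm_le => x x1; rewrite (le_trans (ler_normD _ _))//.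
by rewrite lerD// operator_norm_ub.
Qed.

Fact operator_normZ a f : operator_norm (a *: f) = `|a| * operator_norm f.
Proof.
have le b g : operator_norm (b *: g) <= `|b| * operator_norm g.
  apply: operator_norm_le => x x1.
  by rewrite [X in `|X|]/(b *: g x) normrZ ler_wpM2l// operator_norm_ub.
apply/eqP; rewrite eq_le le /=; have [->|a0] := eqVneq a 0.
  rewrite normr0 mul0r (le_trans (normr_ge0 ((0 *: f : bounded_operator) 0)))//.
  by rewrite operator_norm_ub// normr0.
rewrite -ler_pdivlMl ?normr_gt0// -normfV.
by rewrite -{1}(scale1r f) -(mulVf a0) -scalerA le.
Qed.

Fact operator_norm0_eq0 f : operator_norm f = 0 -> f = 0.
Proof.
move=> f0; apply/val_inj/funext => x; rewrite [RHS]/(0 : W).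
have [->|x0] := eqVneq x 0; first exact: (raddf0 (f : {linear V -> W})).
have x_gt0 : 0 < `|x| by rewrite normr_gt0.
have : `|f (`|x|^-1 *: x)| <= 0.
  by rewrite -f0 operator_norm_ub// normrZ normfV normr_id mulVf// gt_eqF.
rewrite normr_le0 linearZ/= scaler_eq0 invr_eq0 (gt_eqF x_gt0)/=.
by move=> /eqP.
Qed.

HB.instance Definition _ := Lmodule_isNormed.Build R bounded_operator
  operator_norm_ler_normD operator_normZ operator_norm0_eq0.

End BoundedOperators.

Definition dual (R : realType) (V : normedModType R) :=
  bounded_operator V R^o.

Section DualOrder.
Variables (R : realType) (F : banachLattice R).

Definition dual_positive (x' : dual F) : Prop :=
  forall v : F, bl_le 0 v -> 0 <= (x' v : R).

Definition positive_on_dual (S : bounded_operator (dual F) (dual F)) : Prop :=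
  forall x' : dual F, dual_positive x' -> dual_positive (S x').

End DualOrder.

(* The completed projective tensor product of X and Y.  Elements of the
   algebraic tensor product are formal sums of pairs, identified when no
   bilinear map separates them; elements of the completion are sequences that
   are Cauchy for the projective norm, identified when the norm of their
   difference is 0. *)
Section ProjectiveTensor.
Variables (R : realType) (X Y : normedModType R).

Definition formal_sum := seq (X * Y).

Definition formal_eval (W : lmodType R) (b : X -> Y -> W) (s : formal_sum) : W :=
  \sum_(t <- s) b t.1 t.2.

Definition same_tensor (s t : formal_sum) : Prop :=
  forall (W : lmodType R) (b : {bilinear X -> Y -> W}),
    formal_eval b s = formal_eval b t.

Definition formal_sub (s t : formal_sum) : formal_sum :=
  s ++ [seq (- z.1, z.2) | z <- t].

Definition projective_norm (s : formal_sum) : R :=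
  inf [set \sum_(z <- t) `|z.1| * `|z.2| | t in [set t | same_tensor s t]].

Record projective_tensor := ProjectiveTensor {
  ptensor_seq :> nat -> formal_sum ;
  ptensor_cauchy : forall e : R, 0 < e ->
    exists N, forall m n, (N <= m)%N -> (N <= n)%N ->
      projective_norm (formal_sub (ptensor_seq m) (ptensor_seq n)) < e }.

Definition ptensor_norm (u : projective_tensor) : R :=
  limn (fun n => projective_norm (u n)).

(* The duality <S, x (x) y> = <S x, y>, extended by linearity and continuity. *)
Definition ptensor_pairing (S : bounded_operator X (dual Y))
    (u : projective_tensor) : R :=
  limn (fun n => formal_eval (fun x y => S x y : R^o) (u n) : R).

Lemma projective_norm_le (s t : formal_sum) :
  same_tensor s t -> projective_norm s <= \sum_(z <- t) `|z.1| * `|z.2|.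
Proof.
move=> st; apply: ge_inf; last by exists t.
by exists 0 => _ [u _ <-]; apply: sumr_ge0 => z _; rewrite mulr_ge0.
Qed.

Fact simple_tensor_cauchy (x : X) (y : Y) (e : R) : 0 < e ->
  exists N, forall m n, (N <= m)%N -> (N <= n)%N ->
    projective_norm (formal_sub [:: (x, y)] [:: (x, y)]) < e.
Proof.
move=> e0; exists 0%N => _ _ _ _; apply: le_lt_trans e0.
rewrite -[leRHS](big_nil 0 +%R xpredT (fun z : X * Y => `|z.1| * `|z.2|)).
apply: projective_norm_le => W b.
by rewrite /formal_eval/= big_cons big_seq1 big_nil/= linearNl subrr.
Qed.

Definition simple_tensor (x : X) (y : Y) : projective_tensor :=
  @ProjectiveTensor (fun=> [:: (x, y)]) (simple_tensor_cauchy x y).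

Lemma ptensor_pairing_simple S x y :
  ptensor_pairing S (simple_tensor x y) = S x y.
Proof.
rewrite /ptensor_pairing/= /formal_eval big_seq1.
by apply: cvg_lim => //; exact: cvg_cst.
Qed.

Lemma ptensor_norm_simple_le x y :
  ptensor_norm (simple_tensor x y) <= `|x| * `|y|.
Proof.
have -> : ptensor_norm (simple_tensor x y) = projective_norm [:: (x, y)].
  rewrite /ptensor_norm/=; apply: cvg_lim => //; exact: cvg_cst.
by apply: (le_trans (@projective_norm_le _ [:: (x, y)] _)); rewrite ?big_seq1.
Qed.

End ProjectiveTensor.

Section MeasureSpaces.
Context d (Omega : measurableType d) (R : realType).
Variable mu : {measure set Omega -> \bar R}.

Definition strictly_localizable : Prop :=
  exists (I : choiceType) (A : I -> set Omega),
    [/\ partition [set: I] A [set: Omega],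
        forall i, measurable (A i) /\ (mu (A i) < +oo)%E,
        forall B : set Omega,
          measurable B <-> (forall i, measurable (B `&` A i)) &
        forall B : set Omega, measurable B ->
          mu B = (\esum_(i in [set: I]) mu (B `&` A i))%E].

(* Functions into a set D that is identified with the dual of a Banach space:
   [G] is the predual, with norm [normG], and [pairing] is the duality.
   The norm 'N[mu]_+oo is the essential supremum of the absolute value. *)
Section SigmaStar.
Variables (D G : Type) (normG : G -> R) (pairing : D -> G -> R).

Definition sigma_star_norm (f : Omega -> D) : \bar R :=
  ereal_sup [set Lnorm mu +oo%E (fun w => (pairing (f w) v)%:E)
            | v in [set v | normG v <= 1]].

Definition sigma_star (f : Omega -> D) : Prop :=
  (forall v : G, measurable_fun setT (fun w => pairing (f w) v)) /\
  (sigma_star_norm f < +oo)%E.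

End SigmaStar.

Section Bochner.
Variable V : normedModType R.

Definition separable (A : set V) : Prop :=
  exists C : set V, [/\ countable C, C `<=` A & A `<=` closure C].

Definition strongly_measurable (f : Omega -> V) : Prop :=
  (forall phi : dual V, measurable_fun setT (fun w => phi (f w) : R)) /\
  exists2 N : set Omega, mu.-negligible N & separable (f @` (~` N)).

Definition bochner_norm (p : \bar R) (f : Omega -> V) : \bar R :=
  Lnorm mu p (fun w => `|f w|%:E).

(* Representatives of elements of the Bochner space L^p; two of them are the
   same element when they are equal almost everywhere. *)
Record bochnerLp (p : \bar R) := BochnerLp {
  Lp_fun :> Omega -> V ;
  Lp_strongly_measurable : strongly_measurable Lp_fun ;
  Lp_finite : (bochner_norm p Lp_fun < +oo)%E }.

(* Bounded linear operators on L^p, acting on representatives.  In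
   [Lp_op_linear], [h] is any representative of a f + g. *)
Record bounded_Lp_operator (p : \bar R) (T : bochnerLp p -> bochnerLp p) :
    Prop := BoundedLpOperator {
  Lp_op_ae_eq : forall f g : bochnerLp p,
    (f : Omega -> V) = g %[ae mu] -> (T f : Omega -> V) = T g %[ae mu] ;
  Lp_op_linear : forall (a : R) (f g h : bochnerLp p),
    (\forall w \ae mu, h w = a *: f w + g w) ->
    \forall w \ae mu, T h w = a *: T f w + T g w ;
  Lp_op_bounded : exists C : R, forall f : bochnerLp p,
    (bochner_norm p (T f) <= C%:E * bochner_norm p f)%E }.

Definition local_operator (p : \bar R) (T : bochnerLp p -> bochnerLp p) : Prop :=
  forall f : bochnerLp p, \forall w \ae mu, f w = 0 -> T f w = 0.

End Bochner.

Section Multipliers.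
Variable F : banachLattice R.
Local Notation F' := (dual F).
Local Notation L := (bounded_operator (dual F) (dual F)).

Definition multiplier_norm (M : Omega -> L) : \bar R :=
  sigma_star_norm (@ptensor_norm R F' F) (@ptensor_pairing R F' F) M.

Definition multiplier (M : Omega -> L) : Prop :=
  sigma_star (@ptensor_norm R F' F) (@ptensor_pairing R F' F) M.

(* M1 is a representative of the class of M. *)
Definition multiplier_rep (M M1 : Omega -> L) : Prop :=
  multiplier M1 /\ multiplier_norm (fun w => M1 w - M w) = 0%E.

Definition is_multiplication_by (p : \bar R)
    (T : bochnerLp F' p -> bochnerLp F' p) (M : Omega -> L) : Prop :=
  exists2 M0, multiplier_rep M M0 &
    forall f : bochnerLp F' p, \forall w \ae mu, T f w = M0 w (f w).

Definition Lp_positive (p : \bar R) (f : bochnerLp F' p) : Prop :=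
  \forall w \ae mu, dual_positive (f w).

Definition positive_Lp_operator (p : \bar R)
    (T : bochnerLp F' p -> bochnerLp F' p) : Prop :=
  forall f : bochnerLp F' p, Lp_positive f -> Lp_positive (T f).

Definition positive_multiplier (M : Omega -> L) : Prop :=
  exists2 M1, multiplier_rep M M1 & forall w, positive_on_dual (M1 w).

End Multipliers.

End MeasureSpaces.

(* Main.v *)
(* If M has a positive representative M1, then for each fixed v >= 0 the
   functions <(Tf)(w), v> and <M1(w) f(w), v> agree almost everywhere, because f
   is almost separably valued; as Tf is almost separably valued too, countably
   many v suffice to test the positivity of its values.

   Conversely, if T is positive then <M(w) x', v> >= 0 for almost every w, with
   an exceptional set depending on x' and v.  A choice that works at every w
   comes from a lifting.  On a finite measure space a lower density assigns to
   each point w a filter of measurable sets containing all conull sets, such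
   that every measurable E belongs to the filters of almost all points of E.  It
   is obtained by Zorn's lemma over sub-sigma-algebras: adjoining a single set
   is elementary, limits of countable cofinality rest on a maximal inequality in
   the spirit of martingale convergence, and in the remaining chains the union
   of the sigma-algebras is already a sigma-algebra.  Strict localizability glues the
   densities of the pieces.  Refining the filter at w to an ultrafilter U_w, the
   operator M1(w) = lim_{U_w} M, taken weakly, is a positive representative, the
   completeness of the measure making it measurable. *)

Require Import Defs.
From HB Require Import structures.
From mathcomp Require Import all_boot all_order all_algebra.
From mathcomp Require Import all_classical all_reals all_analysis.
From mathcomp Require Import measurable_realfun ess_sup_inf lra.

Set Implicit Arguments.
Unset Strict Implicit.
Unset Printing Implicit Defensive.

Import Order.TTheory GRing.Theory Num.Theory.
Import numFieldNormedType.Exports.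

Local Open Scope classical_set_scope.
Local Open Scope ring_scope.

(** * Lower densities on finite measure spaces *)

Section FiniteMeasure.
Context d (Omega : measurableType d) (R : realType).
Variable mu : {finite_measure set Omega -> \bar R}.

Definition mass (A : set Omega) : R := fine (mu A).

Lemma massE A : measurable A -> mu A = (mass A)%:E.
Proof. by move=> mA; rewrite fineK// fin_num_measure. Qed.

Lemma mass_ge0 A : 0 <= mass A.
Proof. by rewrite fine_ge0. Qed.

Lemma mass0 : mass set0 = 0.
Proof. by rewrite /mass measure0. Qed.

Lemma le_mass A B : measurable A -> measurable B -> A `<=` B ->
  mass A <= mass B.
Proof.
move=> mA mB AB; rewrite -lee_fin -!massE//.
by apply: le_measure; rewrite ?inE.
Qed.

Lemma mass_setU A B : measurable A -> measurable B -> A `&` B = set0 ->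
  mass (A `|` B) = mass A + mass B.
Proof.
move=> mA mB AB; apply: EFin_inj; rewrite EFinD -!massE//; last first.
  exact: measurableU.
by rewrite measureU.
Qed.

Lemma mass_setU_le A B : measurable A -> measurable B ->
  mass (A `|` B) <= mass A + mass B.
Proof.
move=> mA mB; rewrite -lee_fin EFinD -!massE//; last exact: measurableU.
exact: measureU2.
Qed.

Lemma mass_split A B : measurable A -> measurable B ->
  mass A = mass (A `&` B) + mass (A `\` B).
Proof.
move=> mA mB; rewrite -mass_setU ?setUIDK//.
- exact: measurableI.
- exact: measurableD.
- by rewrite setDE setICA -setIA setICr !setI0.
Qed.

Lemma mass0_negligible A : measurable A -> mass A = 0 -> mu.-negligible A.
Proof.
by move=> mA A0; apply/negligibleP => //; have := massE mA; rewrite A0.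
Qed.

Lemma negligible_mass0 A : measurable A -> mu.-negligible A -> mass A = 0.
Proof. by move=> mA /(measure_negligible mA); rewrite /mass => ->. Qed.

(** Intersecting covers of mass at most [1 / (n + 1)] yields a measurable null cover, so the
    measurability of [A] itself never enters. *)
Lemma small_cover_negligible (A : set Omega) :
  (forall e, 0 < e -> exists B, [/\ measurable B, A `<=` B & mass B <= e]) ->
  mu.-negligible A.
Proof.
move=> h; have hn (n : nat) : exists B : set Omega,
    [/\ measurable B, A `<=` B & mass B <= n.+1%:R^-1].
  by apply: h; rewrite invr_gt0.
have [B BP] := choice hn; exists (\bigcap_n B n); split.
- by apply: bigcapT_measurable => n; have [] := BP n.
- have mI : measurable (\bigcap_n B n).
    by apply: bigcapT_measurable => n; have [] := BP n.
  rewrite massE//; congr EFin; apply/eqP; rewrite eq_le mass_ge0 andbT.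
  apply/ler_addgt0Pl => e e0; rewrite addr0.
  pose n := Num.truncn e^-1; have [mB _ Bn] := BP n.
  apply: (@le_trans _ _ (mass (B n))).
    by apply: le_mass => //; apply: bigcap_inf.
  apply: (le_trans Bn); rewrite -[leRHS]invrK lef_pV2 ?posrE ?invr_gt0//.
  by apply/ltW; rewrite truncnS_gt.
- by move=> w Aw n _; have [_ + _] := BP n; apply.
Qed.

(** * Sub-sigma-algebras and Hahn decompositions relative to them *)

Section SubSigmaAlgebra.
Variable S : set_system Omega.
Hypothesis sigmaS : sigma_algebra setT S.
Hypothesis subS : S `<=` measurable.

Lemma subalg_setT : S setT.
Proof. by case: sigmaS => S0 SC _; rewrite -[setT]setD0; exact: SC. Qed.

Lemma subalg_setC A : S A -> S (~` A).
Proof. by case: sigmaS => _ SC _ SA; rewrite -setTD; exact: SC. Qed.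

Lemma subalg_bigcup (F : (set Omega)^nat) : (forall n, S (F n)) ->
  S (\bigcup_n F n).
Proof. by case: sigmaS => _ _; apply. Qed.

Lemma subalg_setU A B : S A -> S B -> S (A `|` B).
Proof.
move=> SA SB; rewrite -bigcup2E; apply: subalg_bigcup.
by case=> [|[|n]]//=; case: sigmaS.
Qed.

Lemma subalg_setI A B : S A -> S B -> S (A `&` B).
Proof.
move=> SA SB; rewrite -[A `&` B]setCK setCI.
by apply/subalg_setC/subalg_setU; exact: subalg_setC.
Qed.

Lemma subalg_setD A B : S A -> S B -> S (A `\` B).
Proof. by move=> SA SB; rewrite setDE; apply/subalg_setI/subalg_setC. Qed.

Lemma subalg_bigcap (F : (set Omega)^nat) : (forall n, S (F n)) ->
  S (\bigcap_n F n).
Proof.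
move=> SF; rewrite -[\bigcap_n _]setCK setC_bigcap.
by apply/subalg_setC/subalg_bigcup => n; exact: subalg_setC.
Qed.

(* The Hahn decomposition, over [S], of the charge [mu (H `\` E) - e * mu H]. *)
Lemma exists_conditional_threshold (E : set Omega) (e : R) : measurable E ->
  exists B, [/\ S B,
    forall H, S H -> H `<=` B -> e * mass H <= mass (H `\` E) &
    forall H, S H -> H `<=` ~` B -> mass (H `\` E) <= e * mass H].
Proof.
move=> mE; have mCE : measurable (~` E) by exact: measurableC.
have muCE : (mu (~` E) < +oo)%E by rewrite ltey_eq fin_num_measure.
(* [X] is [Omega] with [S] as its sigma-algebra; pushing [nu] forward along the identity restricts
   it to [S], so that its Hahn sets lie in [S]. The positive one is, up to null sets, where the
   conditional probability of the complement of [E] is at least [e]. *)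
pose X := g_sigma_algebraType S.
have measX : @measurable _ X = S := sigma_algebra_id sigmaS.
pose f : Omega -> X := idfun.
have mf : measurable_fun setT f.
  move=> _ A; rewrite measX => SA; rewrite setTI; exact: subS.
pose nu : {charge set Omega -> \bar R} :=
  cadd (charge_of_finite_measure (mfrestr mCE muCE))
       (cscale (- e) (charge_of_finite_measure mu)).
have nuE H : S H -> nu H = (mass (H `\` E) - e * mass H)%:E.
  move=> SH; have mH := subS SH.
  rewrite /nu /= /cadd /cscale /charge_of_finite_measure /mfrestr /mrestr /=.
  rewrite -mulNr EFinD EFinM -!massE ?setDE//.
  by apply: measurableI.
pose nuX : {charge set X -> \bar R} := pushforward nu f.
have [P [N [[mP Ppos] [mN Nneg] PN _]]] := Hahn_decomposition (nuX mf).
exists P; split=> [|H SH HP|H SH HP].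
- by rewrite -measX.
- have := Ppos H; rewrite measX => /(_ SH HP).
  by rewrite [X in (_ <= X)%E]nuE// lee_fin subr_ge0.
- have := Nneg H; rewrite measX => /(_ SH).
  rewrite [X in (X <= _)%E]nuE// lee_fin subr_le0; apply.
  by move=> w /HP nPw; have : (P `|` N) w; [rewrite PN|case].
Qed.
End SubSigmaAlgebra.
End FiniteMeasure.

(** * Lower densities on sub-sigma-algebras *)

Section LowerDensity.
Context d (Omega : measurableType d) (R : realType).
Variable mu : {finite_measure set Omega -> \bar R}.
Local Notation mass := (mass mu).

Lemma mass0_subset A B : measurable A -> measurable B -> A `<=` B ->
  mass B = 0 -> mass A = 0.
Proof.
move=> mA mB AB B0; apply/eqP; rewrite eq_le mass_ge0 andbT -B0.
exact: le_mass.
Qed.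

Lemma mass0_setU A B : measurable A -> measurable B ->
  mass A = 0 -> mass B = 0 -> mass (A `|` B) = 0.
Proof.
move=> mA mB A0 B0; apply/eqP; rewrite eq_le mass_ge0 andbT.
by rewrite (le_trans (mass_setU_le mu mA mB))// A0 B0 addr0.
Qed.

Lemma mass_bigcup0 (F : (set Omega)^nat) : (forall n, measurable (F n)) ->
  (forall n, mass (F n) = 0) -> mass (\bigcup_n F n) = 0.
Proof.
move=> mF F0; apply: negligible_mass0; first exact: bigcupT_measurable.
by apply: negligible_bigcup => n; exact: mass0_negligible.
Qed.

(* [phi w] is a filter in [S], thought of as the sets of [S] having density
   one at [w]; [E |-> [set w | phi w E]] is a lower density up to null sets. *)
Record lower_density (S : set_system Omega) (phi : Omega -> set_system Omega) :
    Prop := LowerDensity {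
  ld_sigma : sigma_algebra setT S ;
  ld_measurable : S `<=` measurable ;
  ld_sub : forall w, phi w `<=` S ;
  ld_setT : forall w, phi w setT ;
  ld_setI : forall w A B, phi w A -> phi w B -> phi w (A `&` B) ;
  ld_up : forall w A B, phi w A -> S B -> mass (A `\` B) = 0 -> phi w B ;
  ld_nonnull : forall w A, phi w A -> mass A <> 0 ;
  ld_dense : forall A, S A -> mu.-negligible (A `\` [set w | phi w A]) }.

(** The filters may gain sets that already belong to the smaller sigma-algebra: only monotonicity is
    required, not agreement. *)
Definition density_le (p q : set_system Omega * (Omega -> set_system Omega)) :=
  p.1 `<=` q.1 /\ forall w, p.2 w `<=` q.2 w.

Lemma lower_density_trivial : mass setT <> 0 ->
  lower_density [set set0; setT] (fun=> [set setT]).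
Proof.
move=> T0; split=> /=.
- split; first by left.
  + by move=> A [->|->]; [right; rewrite setD0|left; rewrite setDv].
  + move=> F FP; have [[n Fn]|F0] := pselect (exists n, F n = setT).
      by right; apply/seteqP; split=> // w _; exists n => //; rewrite Fn.
    left; rewrite bigcup0// => n _; have [//|FT] := FP n.
    by case: F0; exists n.
- by move=> _ [->|->].
- by move=> _ _ ->; right.
- by [].
- by move=> _ A B -> ->; rewrite setIT.
- by move=> _ A B -> [->|//]; rewrite setD0.
- by move=> _ _ ->.
- move=> _ [->|->].
    by rewrite set0D; exact: negligible_set0.
  by apply: negligibleS (negligible_set0 _) => w [_]; apply.
Qed.

(** * Adjoining a single set to a lower density *)

Section OneStep.
Variables (S : set_system Omega) (phi : Omega -> set_system Omega).
Hypothesis D : lower_density S phi.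
Let sigmaS := ld_sigma D.
Let mS : S `<=` measurable := ld_measurable D.

(** [A] is the zero set of the conditional expectation given [S] of the indicator of [E], obtained
    as the intersection of the sets where this expectation is at most [1 / (n + 1)]. *)
Lemma exists_max_null_trace (E : set Omega) : measurable E ->
  exists A, [/\ S A, mass (A `&` E) = 0 &
    forall G, S G -> mass (G `&` E) = 0 -> mass (G `\` A) = 0].
Proof.
move=> mE; have mCE : measurable (~` E) by exact: measurableC.
have hn (n : nat) := exists_conditional_threshold mu sigmaS mS n.+1%:R^-1 mCE.
have {hn}[B BP] := choice hn; pose A := \bigcap_n ~` B n.
have SA : S A by apply: subalg_bigcap => // n; apply: subalg_setC => //;
  case: (BP n).
have mB n : measurable (B n) by apply: mS; case: (BP n).
exists A; split=> //.
- apply/eqP; rewrite eq_le mass_ge0 andbT; apply/ler_addgt0Pl => e e0.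
  rewrite addr0; pose n := Num.truncn ((mass A + 1) / e).
  have [_ _ /(_ A SA)] := BP n; rewrite setDE setCK => /(_ _)/le_trans; apply.
    exact: bigcap_inf.
  have A1 : 0 < mass A + 1 by rewrite ltr_wpDl// mass_ge0.
  rewrite ler_pdivrMl// -ler_pdivrMr//.
  apply: (@le_trans _ _ ((mass A + 1) / e)); last exact/ltW/truncnS_gt.
  by rewrite ler_pM2r ?invr_gt0// lerDl.
(* On [B n] the conditional probability of [E] is at least [1 / (n + 1)], so a part of [B n] with
   null trace on [E] is itself null. *)
- move=> G SG GE0; rewrite setDE setC_bigcap setI_bigcupr.
  apply: mass_bigcup0 => n; first by apply: measurableI;
    [exact: mS|rewrite setCK].
  rewrite setCK; have [SB /(_ (G `&` B n)) + _] := BP n.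
  move=> /(_ (subalg_setI sigmaS SG SB) (@subIsetr _ _ _)).
  rewrite [X in _ <= X](_ : _ = 0); last first.
    apply: mass0_subset GE0.
    - by apply: measurableD => //; apply: measurableI => //; exact: mS.
    - by apply: measurableI => //; exact: mS.
    - by move=> w [[Gw _]] /= /contrapT.
  move=> le0; apply/eqP; rewrite eq_le mass_ge0 andbT.
  by move: le0; rewrite pmulr_rle0// invr_gt0.
Qed.

(** At almost every point outside [A] the filter contains the complement of [A]; it cannot contain
    [A] as well, since the empty set is null. *)
Lemma ld_complement_negligible A : S A ->
  mu.-negligible ([set w | phi w A] `\` A).
Proof.
move=> SA; apply: negligibleS (ld_dense D (subalg_setC sigmaS SA)).
move=> w [/= phiA nA]; split=> // phiCA.
apply: (ld_nonnull D (ld_setI D phiA phiCA)).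
by rewrite setICr mass0.
Qed.

(** The sets [G] vary with [w], but each is almost contained in the single maximal set [A], which
    then belongs to the filter at [w]. So [w] lies in the null set where [A] meets [E], or outside
    [A] although [A] has density one there. *)
Lemma incompatible_negligible (E : set Omega) : measurable E -> mu.-negligible
  [set w | E w /\ exists2 G, phi w G & mass (G `&` E) = 0].
Proof.
move=> mE; have [A [SA AE0 Amax]] := exists_max_null_trace mE.
apply: (@negligibleS _ _ _ _ ((A `&` E) `|` ([set w | phi w A] `\` A))).
  move=> w [Ew [G phiG GE0]]; have [Aw|nAw] := pselect (A w); first by left.
  by right; split=> //=; apply: (ld_up D phiG) => //; apply: Amax => //;
    exact: ld_sub D _ _ phiG.
apply: negligibleU; last exact: ld_complement_negligible.
by apply: mass0_negligible => //; apply: measurableI => //; exact: mS.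
Qed.

(** An explicit form of the sigma-algebra generated by [S] and [E]. *)
Definition adjoin (E : set Omega) : set_system Omega :=
  [set K | exists G H, [/\ S G, S H & K = (G `&` E) `|` (H `\` E)]].

Lemma adjoin_sub E : S `<=` adjoin E.
Proof. by move=> A SA; exists A, A; rewrite setUIDK. Qed.

Lemma adjoin_self E : adjoin E E.
Proof.
exists setT, set0; split; first exact: subalg_setT.
- by case: sigmaS.
- by rewrite setTI set0D setU0.
Qed.

Lemma adjoin_measurable E : measurable E -> adjoin E `<=` measurable.
Proof.
move=> mE _ [G [H [/mS mG /mS mH ->]]].
by apply: measurableU; [exact: measurableI|exact: measurableD].
Qed.

Lemma adjoin_sigma_algebra E : sigma_algebra setT (adjoin E).
Proof.
split.
- by apply: adjoin_sub; case: sigmaS.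
- move=> _ [G [H [SG SH ->]]]; exists (~` G), (~` H).
  split; [exact: subalg_setC|exact: subalg_setC|].
  rewrite setTD; apply/seteqP; split=> w /=.
    by have [Ew|Ew] := pselect (E w) => /not_orP[/not_andP nG /not_andP nH];
      [left|right]; tauto.
  by tauto.
- move=> F FP; have [G /choice[H GH]] := choice FP.
  exists (\bigcup_n G n), (\bigcup_n H n); split.
  + by apply: subalg_bigcup => // n; case: (GH n).
  + by apply: subalg_bigcup => // n; case: (GH n).
  + rewrite setI_bigcupl setDE setI_bigcupl -bigcupU.
    by apply: eq_bigcupr => n _; case: (GH n).
Qed.

(** The filter at [w] is enlarged by whichever of [E] and its complement contains [w]. This could
    put a null set in the filter only at [bad] points, and these form a negligible set. *)
Lemma lower_density_extend E : measurable E -> exists S' phi',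
  [/\ lower_density S' phi', density_le (S, phi) (S', phi') & S' E].
Proof.
move=> mE; have mCE : measurable (~` E) by exact: measurableC.
pose side w := if pselect (E w) then E else ~` E.
pose bad w := exists2 G, phi w G & mass (G `&` side w) = 0.
have bad0 : mu.-negligible [set w | bad w].
  apply: negligibleS (negligibleU (incompatible_negligible mE)
    (incompatible_negligible mCE)) => w; rewrite /bad /side /=.
  by case: pselect => [Ew|nEw] badw; [left|right].
(* At a bad point [setT] is used instead, so that neither side is forced into the filter. *)
pose Q w := if pselect (bad w) then setT else side w.
have mQ w : measurable (Q w).
  rewrite /Q; case: pselect => [?|?] /=; first exact: measurableT.
  by rewrite /side; case: pselect => [?|?].
have Qnonnull w G : phi w G -> mass (G `&` Q w) <> 0.
  rewrite /Q; case: pselect => [badw|nbad] /= phiG; last by move=> G0;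
    apply: nbad; exists G.
  by rewrite setIT => G0; apply: (ld_nonnull D phiG).
pose phi' w := [set K | adjoin E K /\ exists2 G,
  phi w G & mass ((G `&` Q w) `\` K) = 0].
have mphi w G : phi w G -> measurable G by move=> /(ld_sub D)/mS.
have mS' := adjoin_measurable mE.
exists (adjoin E), phi'; split; last exact: adjoin_self.
- split=> //.
  + exact: adjoin_sigma_algebra.
  + by move=> w K [].
  + move=> w; split; first by apply: adjoin_sub; exact: subalg_setT.
    by exists setT; [exact: (ld_setT D)|rewrite setDT mass0].
  + move=> w A B [SA [G phiG GA]] [SB [H phiH HB]]; split.
      exact: (subalg_setI (adjoin_sigma_algebra E)).
    exists (G `&` H); first exact: (ld_setI D).
    have mG := mphi _ _ phiG; have mH := mphi _ _ phiH.
    have mA := mS' _ SA; have mB := mS' _ SB.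
    have m1 : measurable ((G `&` Q w) `\` A) by apply: measurableD => //;
      exact: measurableI.
    have m2 : measurable ((H `&` Q w) `\` B) by apply: measurableD => //;
      exact: measurableI.
    apply: (mass0_subset _ _ _ (mass0_setU m1 m2 GA HB)).
    * by apply: measurableD; [apply: measurableI => //;
        exact: measurableI|exact: measurableI].
    * exact: measurableU.
    * by move=> x [[[Gx Hx] Qx]] /= /not_andP[nA|nB]; [left|right].
  + move=> w A B [SA [G phiG GA]] SB AB; split=> //; exists G => //.
    have mG := mphi _ _ phiG; have mA := mS' _ SA; have mB := mS' _ SB.
    have m1 : measurable ((G `&` Q w) `\` A) by apply: measurableD => //;
      exact: measurableI.
    have m2 : measurable (A `\` B) by exact: measurableD.
    apply: (mass0_subset _ _ _ (mass0_setU m1 m2 GA AB)).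
    * by apply: measurableD => //; exact: measurableI.
    * exact: measurableU.
    * by move=> x [GQ nB]; have [Ax|nA] := pselect (A x); [right|left].
  + move=> w A [SA [G phiG GA]] A0; apply: (Qnonnull _ _ phiG) => /=.
    have mG := mphi _ _ phiG; have mA := mS' _ SA.
    have m1 : measurable ((G `&` Q w) `\` A) by apply: measurableD => //;
      exact: measurableI.
    apply: (mass0_subset _ _ _ (mass0_setU m1 mA GA A0)).
    * exact: measurableI.
    * exact: measurableU.
    * by move=> x GQ; have [Ax|nA] := pselect (A x); [right|left].
  (* At a point [w] of [K] that is not bad, [K] coincides on [side w] with [G] or with [H], and [w]
     lies in that set; its density under [phi] gives that of [K] under [phi']. *)
  + move=> K SK; have [G [H [SG SH KE]]] := SK.
    apply: negligibleS (negligibleU bad0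
      (negligibleU (ld_dense D SG) (ld_dense D SH))) => w [Kw nphi].
    have [bw|nbw] := pselect (bad w); [by left|right].
    rewrite KE in Kw; case: Kw => -[Xw Ew]; [left|right]; split=> //= phiX;
      apply: nphi; split=> //; [exists G|exists H] => //.
    * rewrite (_ : _ `\` _ = set0) ?mass0// -subset0 => x [[Gx]].
      rewrite /Q; case: pselect => //= ?; rewrite /side; case: pselect =>
        //= ? Ex.
      by apply; rewrite KE; left.
    * rewrite (_ : _ `\` _ = set0) ?mass0// -subset0 => x [[Gx]].
      rewrite /Q; case: pselect => //= ?; rewrite /side; case: pselect =>
        //= ? Ex.
      by apply; rewrite KE; right.
- split=> [|w G phiG]; first exact: adjoin_sub.
  split; first by apply: adjoin_sub; exact: (ld_sub D phiG).
  exists G => //; rewrite (_ : _ `\` _ = set0) ?mass0// -subset0.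
  by move=> x [[]].
Qed.

End OneStep.
End LowerDensity.

(** * Limits of increasing sequences of lower densities *)

Section LowerDensityLimits.
Context d (Omega : measurableType d) (R : realType).
Variable mu : {finite_measure set Omega -> \bar R}.
Local Notation mass := (mass mu).
Local Notation lower_density := (lower_density mu).

Lemma mass_bigcup_approx (F : (set Omega)^nat) (e : R) :
  (forall n, measurable (F n)) -> nondecreasing_seq F -> 0 < e ->
  exists n, mass (\bigcup_k F k) <= mass (F n) + e.
Proof.
move=> mF ndF e0; have mU : measurable (\bigcup_k F k) by exact:
  bigcupT_measurable.
have : (fun n => (mass (F n))%:E) @ \oo --> (mass (\bigcup_k F k))%:E.
  rewrite -massE// (_ : (fun n => _) = mu \o F).
    exact: nondecreasing_cvg_mu.
  by apply/funext => n; rewrite -massE.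
move=> /fine_cvgP[_] /cvgrPdist_le/(_ e e0)[n _ /(_ n (leqnn n))] /= h.
by exists n; rewrite -lerBlDl; exact: le_trans (ler_norm _) h.
Qed.

Section CountableLimit.
Variable S : nat -> set_system Omega.
Variable phi : nat -> Omega -> set_system Omega.
Hypothesis D : forall n, lower_density (S n) (phi n).
Hypothesis incr : forall n, density_le (S n, phi n) (S n.+1, phi n.+1).

Let sigmaS n := ld_sigma (D n).
Let mS n : S n `<=` measurable := ld_measurable (D n).

Lemma density_le_homo m n : (m <= n)%N -> density_le (S m, phi m) (S n, phi n).
Proof.
move=> /subnK <-; elim: (n - m)%N => [|k [IH1 IH2]].
  by split=> [A|w A]; rewrite add0n.
have [h1 h2] := incr (k + m); rewrite addSn.
by split=> [A /IH1/h1|w A /IH2/h2].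
Qed.

(** For increasing [S n] this is the sigma-algebra generated by their union and the measurable null
    sets, described as a closure for the pseudometric given by the mass of the symmetric
    difference. *)
Definition limit_sets : set_system Omega := [set E | measurable E /\
  forall e, 0 < e ->
    exists n A, S n A /\ mass (E `\` A) + mass (A `\` E) <= e].

Lemma limit_sets_sub n : S n `<=` limit_sets.
Proof.
move=> A SA; split=> [|e e0]; first exact: mS SA.
by exists n, A; rewrite setDv mass0 addr0 ltW.
Qed.

Lemma limit_sets_setD A B : limit_sets A -> limit_sets B ->
  limit_sets (A `\` B).
Proof.
move=> [mA hA] [mB hB]; split=> [|e e0]; first exact: measurableD.
have e2 : 0 < e / 2 by rewrite divr_gt0.
have [i [A' [SA' AA']]] := hA _ e2; have [j [B' [SB' BB']]] := hB _ e2.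
have {}SA' : S (maxn i j) A' by exact: (density_le_homo (leq_maxl i j)).1.
have {}SB' : S (maxn i j) B' by exact: (density_le_homo (leq_maxr i j)).1.
have mA' := mS SA'; have mB' := mS SB'.
exists (maxn i j), (A' `\` B'); split; first exact: (subalg_setD (sigmaS _)).
have sub_le (X Y X' Y' : set Omega) : measurable X -> measurable Y ->
    measurable X' -> measurable Y' ->
    mass ((X `\` Y) `\` (X' `\` Y')) <= mass (X `\` X') + mass (Y' `\` Y).
  move=> mX mY mX' mY'.
  have m1 : measurable (X `\` X') by exact: measurableD.
  have m2 : measurable (Y' `\` Y) by exact: measurableD.
  apply: le_trans (mass_setU_le mu m1 m2); apply: le_mass.
  - by apply: measurableD; exact: measurableD.
  - exact: measurableU.
  - by move=> x [[Xx nYx]] /not_andP[nX'|/contrapT Y'x]; [left|right].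
have := sub_le _ _ _ _ mA mB mA' mB'; have := sub_le _ _ _ _ mA' mB' mA mB.
lra.
Qed.

(** Differences are continuous for the pseudometric, and an increasing union is approximated by one
    of its terms. *)
Lemma limit_sets_sigma_algebra : sigma_algebra setT limit_sets.
Proof.
apply/sigma_algebraP => //; split.
- by apply: (@limit_sets_sub 0); exact: (subalg_setT (sigmaS _)).
- by move=> A B _; exact: limit_sets_setD.
- move=> F ndF TF; have mF n : measurable (F n) by case: (TF n).
  split=> [|e e0]; first exact: bigcupT_measurable.
  have mU : measurable (\bigcup_k F k) by exact: bigcupT_measurable.
  have e2 : 0 < e / 2 by rewrite divr_gt0.
  have [k hk] := mass_bigcup_approx mF ndF e2.
  have [_ /(_ _ e2)[n [A [SA FA]]]] := TF k; have mA := mS SA.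
  have Fk : F k `<=` \bigcup_k F k by exact: bigcup_sup.
  exists n, A; split=> //; rewrite [e]splitr.
  have m1 : measurable (\bigcup_k F k `\` F k) by exact: measurableD.
  have m2 : measurable (F k `\` A) by exact: measurableD.
  apply: (@le_trans _ _ ((mass (\bigcup_k F k `\` F k) + mass (F k `\` A)) +
      mass (A `\` F k))).
    apply: lerD.
    - apply: le_trans (mass_setU_le mu m1 m2); apply: le_mass.
      + exact: measurableD.
      + exact: measurableU.
      + by move=> x [Ux nAx]; have [Fx|nFx] := pselect (F k x); [right|left].
    - apply: le_mass; [exact: measurableD|exact: measurableD|].
      by move=> x [Ax nUx]; split=> // Fx; apply: nUx; exact: Fk.
  rewrite -addrA lerD// -(lerD2l (mass (F k))) -[X in X + _](_ : mass
    (\bigcup_k F k `&` F k) = _).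
    by rewrite -mass_split.
  by rewrite setIidr.
- by move=> A B TA TB; rewrite -setDD; apply/limit_sets_setD/limit_sets_setD.
Qed.

(* Following the martingale convergence theorem, [E] has density one at [w]
   when the conditional expectations of its indicator tend to one at [w]; the
   values at [w] of conditional expectations are read off [phi m w]. *)
Definition near_density (e : R) (E : set Omega) (w : Omega) := exists n,
  forall m, (n <= m)%N -> exists2 G, phi m w G &
    forall H, S m H -> H `<=` G -> mass (H `\` E) <= e * mass H.

Definition limit_density (w : Omega) : set_system Omega :=
  [set E | limit_sets E /\ forall e, 0 < e -> near_density e E w].

(** A maximal inequality. Approximate [E] by [E'] in [S n], and let [B i] be where the conditional
    probability of the complement of [E], given [S (n + i)], is at least [e]. Splitting the union of
    the traces of the [B i] on [E'] by the first index that catches a point bounds its mass by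
    [mass (E' \ E) / e]. At almost all remaining points of [E'], the sets [E' \ B i] witness the
    density of [E] at every stage. *)
Lemma near_density_negligible e E : 0 < e -> limit_sets E ->
  mu.-negligible (E `\` [set w | near_density e E w]).
Proof.
move=> e0 [mE hE]; apply: (@small_cover_negligible _ _ _ mu) => r r0.
have e1 : 0 < 1 + e^-1 by rewrite addr_gt0// invr_gt0.
(* Chosen so that [eta + eta / e = r / 2]: the first term pays for [E \ E'], the second for the
   caught points. The other [r / 2] pays for truncating the infinite union. *)
pose eta := r / 2 / (1 + e^-1).
have eta0 : 0 < eta by rewrite !divr_gt0.
have [n [E' [SE' EE']]] := hE _ eta0.
have hB (i : nat) := exists_conditional_threshold mu (sigmaS (n + i)) (@mS _)
  e mE.
have {hB}[B BP] := choice hB.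
have SE'i i : S (n + i) E' by exact: (density_le_homo (leq_addr i n)).1.
have mE' := mS SE'.
have SB i : S (n + i) (B i) by case: (BP i).
pose bad k := \big[setU/set0]_(i < k) (E' `&` B i).
have badP k : S (n + k) (bad k) /\ e * mass (bad k) <= mass (bad k `\` E).
  elim: k => [|k [IH1 IH2]].
    rewrite /bad big_ord0 set0D mass0 mulr0; split=> //.
    by case: (sigmaS (n + 0)).
  have Sk : S (n + k) (bad k `|` (E' `&` B k)).
    by apply: (subalg_setU (sigmaS _)) => //; exact: (subalg_setI (sigmaS _)).
  have -> : bad k.+1 = bad k `|` (E' `&` B k) by rewrite /bad big_ord_recr.
  split; first by apply: (density_le_homo _).1 Sk; rewrite addnS.
  (* The points caught for the first time at stage [k]: this part is disjoint from [bad k],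
     contained in [B k], and in [S (n + k)], so the threshold inequality applies to it. *)
  pose H := (E' `&` B k) `\` bad k.
  have SH : S (n + k) H by apply: (subalg_setD (sigmaS _)) => //;
    exact: (subalg_setI (sigmaS _)).
  have -> : bad k `|` (E' `&` B k) = bad k `|` H.
    rewrite /H; apply/seteqP; split=> x [bx|Hx]; try by left.
      by have [bx|nbx] := pselect (bad k x); [left|right].
    by right; case: Hx.
  have mbad := mS IH1; have mH := mS SH.
  have dis : bad k `&` H = set0 by rewrite /H setDIK.
  rewrite mass_setU// mulrDr setDUl mass_setU; last first.
  + by rewrite -subset0 -dis => x [[? _] [? _]].
  + exact: measurableD.
  + exact: measurableD.
  apply: lerD => //; have [_ h _] := BP k; apply: h => //.
  by move=> x [[_ ?] _].
have mbad k : measurable (bad k) by case: (badP k) => /mS.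
have mU : measurable (\bigcup_k bad k) by exact: bigcupT_measurable.
have nd : nondecreasing_seq bad.
  apply/nondecreasing_seqP => k; apply/subsetPset.
  by rewrite /bad big_ord_recr; left.
have bad_le k : mass (bad k) <= eta / e.
  rewrite ler_pdivlMr// mulrC (le_trans (badP k).2)//.
  apply: le_trans EE'; rewrite ler_wpDl ?mass_ge0//; apply: le_mass.
  - exact: measurableD.
  - exact: measurableD.
  - apply: setSD; rewrite /bad -(bigcup_mkord k (fun i => E' `&` B i)).
    by apply: bigcup_sub => i _ x [].
have [k hk] := mass_bigcup_approx mbad nd (divr_gt0 r0 (ltr0n _ 2)).
have : mu.-negligible (\bigcup_i ((E' `\` B i) `\`
    [set w | phi (n + i) w (E' `\` B i)])).
  by apply: negligible_bigcup => i; apply: (ld_dense (D _));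
    exact: (subalg_setD (sigmaS _)).
move=> [N [mN N0 badN]].
have mEE' : measurable (E `\` E') by exact: measurableD.
exists ((E `\` E') `|` (\bigcup_k bad k) `|` N); split.
- by apply: measurableU => //; exact: measurableU.
- move=> w [Ew nw]; have [E'w|nE'w] := pselect (E' w); last by left; left.
  have [[k' _ bw]|nbw] := pselect ((\bigcup_k bad k) w); first by left; right;
    exists k'.
  have nB i : ~ B i w.
    move=> Bw; apply: nbw; exists i.+1 => //.
    by rewrite /bad big_ord_recr; right.
  apply: contrapT => /not_orP[_ nN]; apply: nw; exists n => m nm.
  rewrite -(subnKC nm); exists (E' `\` B (m - n)%N).
    apply: contrapT => nphi; apply/nN/badN; exists (m - n)%N => //.
  by move=> H SH HE; have [_ _] := BP (m - n)%N; apply=> // x /HE[].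
- have mEU : measurable ((E `\` E') `|` \bigcup_k bad k) by exact: measurableU.
  apply: (le_trans (mass_setU_le mu mEU mN)).
  rewrite [X in _ + X](_ : _ = 0) ?addr0; last by rewrite /mass N0.
  apply: (le_trans (mass_setU_le mu mEE' mU)).
  apply: (@le_trans _ _ (eta + (eta / e + r / 2))).
    rewrite lerD//; last by rewrite (le_trans hk)// lerD2r.
    by apply: le_trans EE'; rewrite lerDl mass_ge0.
  rewrite addrA -[X in X + _](_ : eta * (1 + e^-1) = _);
    last by rewrite mulrDr mulr1.
  by rewrite /eta divfK ?gt_eqF// -splitr.
Qed.

Lemma lower_density_limit : lower_density limit_sets limit_density.
Proof.
split.
- exact: limit_sets_sigma_algebra.
- by move=> A [].
- by move=> w A [].
- move=> w; split=> [|e e0]; first exact: subalg_setT limit_sets_sigma_algebra.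
  exists 0%N => m _; exists setT; first exact: (ld_setT (D m)).
  by move=> H _ _; rewrite setDT mass0 mulr_ge0 ?mass_ge0// ltW.
- move=> w A B [TA hA] [TB hB]; split.
    exact: (subalg_setI limit_sets_sigma_algebra).
  have mA := TA.1; have mB := TB.1.
  move=> e e0; have e2 : 0 < e / 2 by rewrite divr_gt0.
  have [i hi] := hA _ e2; have [j hj] := hB _ e2.
  exists (maxn i j) => m; rewrite geq_max => /andP[im jm].
  have [G phiG GP] := hi _ im; have [H phiH HP] := hj _ jm.
  exists (G `&` H); first exact: (ld_setI (D m)).
  move=> K SK KGH; have mK := mS SK; rewrite [e]splitr mulrDl.
  have m1 : measurable (K `\` A) by exact: measurableD.
  have m2 : measurable (K `\` B) by exact: measurableD.
  apply: (@le_trans _ _ (mass (K `\` A) + mass (K `\` B))).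
    apply: le_trans (mass_setU_le mu m1 m2); rewrite setDIr//.
  by apply: lerD; [apply: GP|apply: HP] => // x /KGH[].
- move=> w A B [TA hA] TB AB; split=> // e e0; have [n hn] := hA _ e0.
  have mA := TA.1; have mB := TB.1.
  exists n => m /hn[G phiG GP]; exists G => // H SH HG; have mH := mS SH.
  have m1 : measurable (H `\` A) by exact: measurableD.
  have m2 : measurable (A `\` B) by exact: measurableD.
  apply: le_trans (GP _ SH HG); rewrite -[leRHS]addr0 -AB.
  apply: le_trans (mass_setU_le mu m1 m2); apply: le_mass.
  + exact: measurableD.
  + exact: measurableU.
  + by move=> x [Hx nBx]; have [Ax|nAx] := pselect (A x); [right|left].
(* With [e = 1 / 2], a null [A] would give [mass G <= mass G / 2] for some [G] in a filter, hence a
   null [G]. *)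
- move=> w A [TA hA] A0; have [n /(_ _ (leqnn n))[G phiG GP]] :=
    hA _ (@divr_gt0 R 1 2 ltr01 (ltr0n _ 2)).
  have SG := ld_sub (D n) phiG; have mG := mS SG.
  apply: (ld_nonnull (D n) phiG).
  have := GP _ SG (@subset_refl _ _); rewrite (mass_split mu mG TA.1).
  have -> : mass (G `&` A) = 0.
    have mGA : measurable (G `&` A) by apply: measurableI => //; exact: TA.1.
    exact: (mass0_subset mGA TA.1 (@subIsetr _ _ _) A0).
  rewrite add0r => h; have := mass_ge0 mu (G `\` A); lra.
(* The condition is monotone in [e], so the countably many values [1 / (k + 1)] suffice. *)
- move=> E TE.
  apply: (@negligibleS _ _ _ _ (\bigcup_k (E `\` [set w | near_density
    k.+1%:R^-1 E w]))).
    move=> w [Ew nw]; apply: contrapT => nU; apply: nw; split=> // e e0.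
    pose k := Num.truncn e^-1.
    have : near_density k.+1%:R^-1 E w.
      by apply: contrapT => nd; apply: nU; exists k.
    move=> [n hn]; exists n => m /hn[G phiG GP]; exists G => // H SH HG.
    apply: le_trans (GP _ SH HG) _; rewrite ler_wpM2r ?mass_ge0//.
    rewrite -[leRHS]invrK lef_pV2 ?posrE ?invr_gt0//.
    by apply/ltW; rewrite truncnS_gt.
  apply: negligible_bigcup => k; exact: near_density_negligible.
Qed.

Lemma limit_density_ge n : density_le (S n, phi n) (limit_sets, limit_density).
Proof.
split=> [|w A phiA]; first exact: limit_sets_sub.
have SA := ld_sub (D n) phiA.
split=> [|e e0]; first exact: limit_sets_sub SA.
exists n => m nm; exists A; first exact: (density_le_homo nm).2.
move=> H _ HA; rewrite (_ : H `\` A = set0) ?mass0.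
  by rewrite mulr_ge0 ?mass_ge0// ltW.
by rewrite -subset0 => x [/HA].
Qed.

End CountableLimit.

End LowerDensityLimits.

(** * Existence of a lower density on all measurable sets by Zorn's lemma *)

Section LowerDensityExistence.
Context d (Omega : measurableType d) (R : realType).
Variable mu : {finite_measure set Omega -> \bar R}.
Local Notation mass := (mass mu).
Local Notation lower_density := (lower_density mu).
Local Notation system := (set_system Omega * (Omega -> set_system Omega))%type.

Lemma density_lexx (p : system) : density_le p p.
Proof. by split=> [A|w A]. Qed.

Lemma density_le_trans (q p r : system) :
  density_le p q -> density_le q r -> density_le p r.
Proof. by move=> [pq pq'] [qr qr']; split=> [A /pq/qr|w A /pq'/qr']. Qed.

(** Countably many sets of the union lie in the sigma-algebra of one member, because sequences in
    [C] are bounded in [C]. Hence the union is already a sigma-algebra. *)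
Lemma lower_density_directed_union (C : set system) :
  (forall p, C p -> lower_density p.1 p.2) ->
  (forall p q, C p -> C q -> density_le p q \/ density_le q p) ->
  (forall c : nat -> system, (forall n, C (c n)) ->
    exists2 p, C p & forall n, density_le (c n) p) ->
  C !=set0 ->
  lower_density [set A | exists2 p, C p & p.1 A]
    (fun w => [set A | exists2 p, C p & p.2 w A]).
Proof.
move=> LD total dir [p0 Cp0].
have dir2 p q : C p -> C q -> exists r, [/\ C r,
  density_le p r & density_le q r].
  by move=> Cp Cq; have [pq|qp] := total p q Cp Cq; [exists q|exists p];
    split=> //;
    exact: density_lexx.
split.
- split.
  + by exists p0 => //; case: (ld_sigma (LD _ Cp0)).
  + move=> A [p Cp pA]; exists p => //.
    by rewrite setTD; exact: (subalg_setC (ld_sigma (LD _ Cp))).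
  + move=> F CF.
    have /choice[c cP] : forall n, exists p, C p /\ p.1 (F n).
      by move=> n; have [p Cp pF] := CF n; exists p.
    have [p Cp hp] := dir c (fun n => (cP n).1).
    exists p => //; apply: (subalg_bigcup (ld_sigma (LD _ Cp))) => n.
    exact: (hp n).1 _ (cP n).2.
- by move=> A [p /LD LDp pA]; exact: (ld_measurable LDp).
- by move=> w A [p Cp /(ld_sub (LD _ Cp))]; exists p.
- by move=> w; exists p0 => //; exact: (ld_setT (LD _ Cp0)).
- move=> w A B [p Cp pA] [q Cq qB]; have [r [Cr [_ pr] [_ qr]]] :=
    dir2 _ _ Cp Cq.
  by exists r => //; apply: (ld_setI (LD _ Cr)); [exact: pr|exact: qr].
- move=> w A B [p Cp pA] [q Cq qB] AB; have [r [Cr [_ pr] [qr _]]] :=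
    dir2 _ _ Cp Cq.
  by exists r => //; apply: (ld_up (LD _ Cr)) AB; [exact: pr|exact: qr].
- by move=> w A [p Cp pA]; exact: (ld_nonnull (LD _ Cp) pA).
- move=> A [p Cp pA]; apply: negligibleS (ld_dense (LD _ Cp) pA).
  by move=> w [Aw nA]; split=> // phiA; apply: nA; exists p.
Qed.

(** If no sequence is cofinal in the chain, totality bounds every sequence by a member and the plain
    union works. Otherwise a cofinal sequence is made increasing and its limit density is taken. *)
Lemma lower_density_chain (C : set system) :
  (forall p, C p -> lower_density p.1 p.2) ->
  (forall p q, C p -> C q -> density_le p q \/ density_le q p) ->
  C !=set0 ->
  exists p, lower_density p.1 p.2 /\ forall q, C q -> density_le q p.
Proof.
move=> LD total C0.
have [[c [Cc cof]]|ncof] := pselect (exists c : nat -> system,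
    (forall n, C (c n)) /\ forall p, C p -> exists n, density_le p (c n));
      last first.
  exists ([set A | exists2 p, C p & p.1 A],
    fun w => [set A | exists2 p, C p & p.2 w A]); split=> /=; last first.
    by move=> q Cq; split=> [A qA|w A qA]; exists q.
  apply: lower_density_directed_union => // c Cc; apply: contrapT => nub.
  apply: ncof; exists c; split=> // p Cp; apply: contrapT => ncp.
  apply: nub; exists p => // n; have [//|pc] := total (c n) p (Cc n) Cp.
  by case: ncp; exists n.
(* The running maximum of [c], which is increasing and still cofinal. *)
pose e := fix e n := if n is m.+1 then
  if pselect (density_le (e m) (c m.+1)) then c m.+1 else e m else c 0%N.
have Ce n : C (e n).
  by elim: n => [|n IH] /=; [exact: Cc|case: pselect => ? /=].
have ce n : density_le (c n) (e n).
  case: n => [|n] /=; first exact: density_lexx.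
  case: pselect => [?|nle] /=; first exact: density_lexx.
  by have [] := total _ _ (Ce n) (Cc n.+1).
have incr n : density_le ((e n).1, (e n).2) ((e n.+1).1, (e n.+1).2).
  rewrite -!surjective_pairing /=.
  by case: pselect => //= ?; exact: density_lexx.
exists (limit_sets mu (fun n => (e n).1),
  limit_density mu (fun n => (e n).1) (fun n => (e n).2)); split=> /=.
  by apply: lower_density_limit => // n; exact: LD.
move=> q /cof[n qc]; apply: density_le_trans qc _;
  apply: density_le_trans (ce n) _.
rewrite [e n]surjective_pairing.
exact: (@limit_density_ge _ _ _ mu (fun n => (e n).1) (fun n =>
  (e n).2) (fun n => LD _ (Ce n)) incr n).
Qed.

(** A maximal lower density is defined on every measurable set, since any such set could be
    adjoined. A total mass of zero is excluded because the filters contain [setT] but no null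
    set. *)
Theorem exists_lower_density : mass setT <> 0 ->
  exists phi, lower_density measurable phi.
Proof.
move=> T0; pose P := {p : system | lower_density p.1 p.2}.
pose t0 : P := exist _ ([set set0; setT], fun=>
  [set setT]) (lower_density_trivial T0).
pose le (p q : P) := `[< density_le (sval p) (sval q) >].
have [||C totC|[[S phi] LD] max] := @ZL_preorder P t0 le.
- by move=> p; apply/asboolP; exact: density_lexx.
- by move=> q p r /asboolP pq /asboolP qr; apply/asboolP;
    exact: density_le_trans pq qr.
- have [C0|C0] := pselect (C !=set0); last first.
    by exists t0 => s Cs; case: C0; exists s.
  have [||| p [LDp pub]] := @lower_density_chain (sval @` C).
  + by move=> _ [[p LDp] _ <-].
  + move=> _ _ [p Cp <-] [q Cq <-].
    by have [/asboolP|/asboolP] := totC _ _ Cp Cq; [left|right].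
  + by case: C0 => p Cp; exists (sval p), p.
  + by exists (exist _ p LDp) => s Cs; apply/asboolP/pub; exists s.
- rewrite /= in LD max; exists phi.
  suff SE : S = measurable by rewrite -SE.
  apply/seteqP; split; first exact: ld_measurable LD.
  move=> E mE; have [S' [phi' [LD' le' S'E]]] := lower_density_extend LD mE.
  have := max (exist _ (S', phi') LD'); rewrite /le /= =>
    /(_ (asboolT le'))/asboolP[].
  by move=> + _; apply.
Qed.

End LowerDensityExistence.

(** * Density ultrafilters on strictly localizable spaces *)

Section LocalizableUltrafilters.
Context d (Omega : measurableType d) (R : realType).
Variable mu : {measure set Omega -> \bar R}.
Hypothesis mu_complete : measure_is_complete mu.
Hypothesis mu_localizable : strictly_localizable mu.

(** Negligibility can be tested on the pieces: by completeness the traces of [B] are measurable,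
    hence so is [B], and its measure is the sum of those of the traces. *)
Lemma localizable_pieces : exists (I : choiceType) (A : I -> set Omega),
  [/\ forall i, measurable (A i) /\ (mu (A i) < +oo)%E,
      forall w, exists i, A i w,
      forall i j w, A i w -> A j w -> i = j &
      forall B, (forall i, mu.-negligible (B `&` A i)) -> mu.-negligible B].
Proof.
have [I [A [[cov triv _] mA measE muE]]] := mu_localizable.
exists I, A; split=> //.
- by move=> w; have : [set: Omega] w by []; rewrite -cov => -[i _ Aiw];
    exists i.
- by move=> i j w Ai Aj; apply: triv => //; exists w.
- move=> B negB; have mB : measurable B by apply/measE => i; exact: mu_complete.
  suff muB : mu B = 0%E by apply/negligibleP.
  rewrite muE// esum1// => i _.
  apply: measure_negligible => //; apply: measurableI => //.
  by case: (mA i).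
Qed.

Lemma exists_density_ultrafilters : exists (N : set Omega)
    (U : Omega -> set_system Omega),
  [/\ mu.-negligible N,
      forall w, ~ N w -> UltraFilter (U w),
      forall w E, ~ N w -> mu.-negligible (~` E) -> U w E &
      forall E, measurable E -> mu.-negligible (E `\` [set w | U w E])].
Proof.
have [I [A [mA covA injA negA]]] := localizable_pieces.
pose restr i := mfrestr (mA i).1 (mA i).2.
have restrE i B : mass (restr i) B = fine (mu (B `&` A i)) by [].
have fineE i B : measurable B -> mass (restr i) B = 0 -> mu (B `&` A i) = 0%E.
  move=> mB; rewrite /mass => B0; rewrite -[LHS]/(restr i B) -[LHS]fineK.
    by rewrite B0.
  exact: fin_num_measure.
have /choice[phi phiP] : forall i, exists phi, mu (A i) <> 0%E ->
    lower_density (restr i) measurable phi.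
  move=> i; have [Ai0|Ai0] := pselect (mu (A i) = 0%E).
    (* An arbitrary value: nothing is claimed on a null piece. *)
    by exists (fun=> setT).
  have [|phi LD] := @exists_lower_density _ _ _ (restr i); last by exists phi.
  by move/(fineE _ _ measurableT); rewrite setTI.
have /choice[idx Aidx] := covA.
(* The union of the null pieces, where no lower density is available. There may be uncountably many,
   but negligibility is tested piece by piece. *)
pose N := [set w | mu (A (idx w)) = 0%E].
pose F w := [set K | exists2 E, phi (idx w) w E & E `<=` K].
have LD w : ~ N w -> lower_density (restr (idx w)) measurable (phi (idx w)).
  exact: phiP.
have FF w : ~ N w -> ProperFilter (F w).
  move=> /LD LDw; split.
    move=> [E phiE]; rewrite subset0 => E0.
    by apply: (ld_nonnull LDw phiE); rewrite E0 mass0.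
  split.
  - by exists setT => //; exact: (ld_setT LDw).
  - move=> P Q [E phiE EP] [G phiG GQ]; exists (E `&` G).
      exact: (ld_setI LDw).
    exact: setISS.
  - by move=> P Q PQ [E phiE EP]; exists E => //; exact: subset_trans PQ.
have /choice[U UP] : forall w, exists U, ~ N w -> UltraFilter U /\ F w `<=` U.
  move=> w; have [Nw|/[dup] nNw /FF FFw] := pselect (N w).
    by exists (fun=> True) => /(_ Nw).
  by have [U UU] := ultraFilterLemma FFw; exists U.
exists N, U; split.
- apply: negA => i; have [Ai0|Ai0] := pselect (mu (A i) = 0%E).
    apply: negligibleS (@subIsetr _ _ _) _.
    by apply/negligibleP => //; case: (mA i).
  apply: negligibleS (negligible_set0 _) => w [Nw Aiw].
  by apply: Ai0; rewrite (injA _ _ _ Aiw (Aidx w)).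
- by move=> w /UP[].
- move=> w E nNw negE; have [_] := UP w nNw; apply; exists E => //.
  have mCE : measurable (~` E) by exact: mu_complete.
  have mE : measurable E by rewrite -[E]setCK; exact: measurableC.
  apply: (ld_up (LD _ nNw) (ld_setT (LD _ nNw) w)) => //.
  rewrite restrE setTD; rewrite (_ : mu _ = 0%E)//.
  apply: measure_negligible; first by apply: measurableI => //;
    case: (mA (idx w)).
  by apply: negligibleS negE => x [].
- move=> E mE; apply: negA => i.
  have [Ai0|Ai0] := pselect (mu (A i) = 0%E).
    apply: negligibleS (@subIsetr _ _ _) _.
    by apply/negligibleP => //; case: (mA i).
  have [B [mB B0 EB]] := ld_dense (phiP _ Ai0) mE.
  exists (B `&` A i); split=> //.
    by apply: measurableI => //; case: (mA i).
  move=> w [[Ew nU] Aiw]; split=> //; apply: EB; split=> // phiE; apply: nU.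
  have idxE : idx w = i by exact: injA (Aidx w) Aiw.
  have [|_] := UP w; first by rewrite /N /= idxE.
  by apply; exists E => //; rewrite idxE.
Qed.

End LocalizableUltrafilters.

(** * Ultralimits of operators and the projective tensor product *)

Section BoundedOperators.
Context (R : realType).

Lemma exists_bounded_operator (V W : normedModType R) (f : V -> W) (K : R) :
  linear f -> (forall x, `|f x| <= K * `|x|) ->
  exists S : bounded_operator V W, forall x, S x = f x.
Proof.
move=> lf fK; pose g : {linear V -> W} :=
  HB.pack f (GRing.isLinear.Build _ _ _ _ f lf).
have cf : continuous f.
  apply: (bounded_linear_continuous (f := g)).
  apply/linear_boundedP; apply: filterS (nbhs_pinfty_ge (num_real K)) => r Kr x.
  by apply: (le_trans (fK x)); rewrite ler_wpM2r.
have Pf : f \in bounded_operator_pred (V := V) (W := W) by apply/asboolP; split.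
by exists (BoundedOperator Pf).
Qed.

Lemma operator_norm_scale (V W : normedModType R) (S : bounded_operator V W) x :
  `|S x| <= `|S| * `|x|.
Proof.
have [->|x0] := eqVneq x 0.
  by rewrite (raddf0 (S : {linear V -> W})) !normr0 mulr0.
have x_gt0 : 0 < `|x| by rewrite normr_gt0.
rewrite -ler_pdivrMr// mulrC.
have -> : `|x|^-1 * `|S x| = `|S (`|x|^-1 *: x)|.
  by rewrite linearZ normrZ normfV normr_id.
by apply: operator_norm_ub; rewrite normrZ normfV normr_id mulVf// gt_eqF.
Qed.

Lemma exists_operator_to_dual (X Y : normedModType R) (b : X -> Y ->
  R) (K : R) :
  0 <= K ->
  (forall x, linear (b x : Y -> R^o)) -> (forall y, linear (b ^~ y : X ->
    R^o)) ->
  (forall x y, `|b x y| <= K * `|x| * `|y|) ->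
  exists S : bounded_operator X (dual Y), forall x y, S x y = b x y.
Proof.
move=> K0 lb rb bK.
have /choice[f fE] : forall x, exists f : dual Y, forall y, f y = b x y.
  by move=> x; apply: (@exists_bounded_operator Y R^o (b x) (K * `|x|)) =>
    // y; exact: bK.
have [||S SE] := @exists_bounded_operator X (dual Y) f K.
- move=> a x x'; apply/val_inj/funext => y.
  rewrite [LHS]fE [RHS]/(a *: f x y + f x' y : R^o) !fE.
  exact: rb.
- move=> x; apply: operator_norm_le => y y1; rewrite [X in `|X|]fE.
  by rewrite (le_trans (bK _ _))// ler_piMr// mulr_ge0.
- by exists S => x y; rewrite SE fE.
Qed.

(** Compactness of the segment from [-K] to [K] provides a cluster point, and an ultrafilter
    converges to each of its cluster points. *)
Lemma ultra_bounded_cvg (T : Type) (U : set_system T) (f : T -> R) (K : R) :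
  UltraFilter U -> U [set t | `|f t| <= K] -> cvg (f @ U).
Proof.
move=> UU UK; apply/cvg_ex.
have cK : compact `[- K, K] := @segment_compact R (- K) K.
have fU : (f @ U) [set` `[- K, K]].
  apply: (@filterS _ U _ [set t | `|f t| <= K] _ _ UK) => t /= ft.
  by rewrite in_itv/=; move: ft; rewrite ler_norml.
have [p [_ clp]] := cK (f @ U) _ fU.
exists p => V pV; have [//|UC] := in_ultra_setVsetC (f @^-1` V) UU.
by have [x [/= nVx Vx]] := clp (~` V) V UC pV.
Qed.

(** The limit is taken for each pair [x], [y] separately. The set where the bound holds may depend
    on the pair, yet the limits satisfy it for all pairs and so define an operator. *)
Lemma exists_ultralimit_operator (T : Type) (U : set_system T)
    (X Y : normedModType R) (M : T -> bounded_operator X (dual Y)) (K : R) :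
  UltraFilter U -> 0 <= K ->
  (forall x y, U [set t | `|M t x y : R| <= K * `|x| * `|y|]) ->
  exists S : bounded_operator X (dual Y),
    forall x y, (fun t => M t x y : R) @ U --> (S x y : R).
Proof.
move=> UU K0 MK; pose b x y : R := lim ((fun t => M t x y : R) @ U).
have bP x y : (fun t => M t x y : R) @ U --> b x y.
  exact: ultra_bounded_cvg (MK x y).
have bE x y (l : R) : (fun t => M t x y : R) @ U --> l -> b x y = l.
  exact: cvg_lim.
have [|x|y|x y|S SE] := @exists_operator_to_dual X Y b K.
- by [].
- move=> a y y'; apply: bE.
  rewrite (_ : (fun t => _) = fun t => a * (M t x y : R) + (M t x y' : R)).
    by apply: cvgD => //; apply: cvgM => //; exact: cvg_cst.
  by apply/funext => t; rewrite linearP.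
- move=> a x x'; apply: bE.
  rewrite (_ : (fun t => _) = fun t => a * (M t x y : R) + (M t x' y : R)).
    by apply: cvgD => //; apply: cvgM => //; exact: cvg_cst.
  by apply/funext => t; rewrite linearP.
- apply: (cvgr_to_le (cvg_norm (bP x y))); exact: MK.
- by exists S => x y; rewrite SE.
Qed.

End BoundedOperators.

(** * The projective norm and its duality with operators *)

Section ProjectiveTensorBounds.
Context (R : realType) (X Y : normedModType R).
Local Notation formal_sum := (formal_sum X Y).
Local Notation projective_norm := (@projective_norm R X Y).
Local Notation ev S := (formal_eval (fun x y => S x y : R^o)).

Lemma formal_eval_cat (W : lmodType R) (b : X -> Y -> W) (s t : formal_sum) :
  formal_eval b (s ++ t) = formal_eval b s + formal_eval b t.
Proof. by rewrite /formal_eval big_cat. Qed.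

Lemma formal_eval_sub (W : lmodType R) (b : X -> Y -> W) (s t : formal_sum) :
  (forall y, linear (b ^~ y)) ->
  formal_eval b (formal_sub s t) = formal_eval b s - formal_eval b t.
Proof.
move=> lb; rewrite /formal_sub formal_eval_cat; congr (_ + _).
rewrite /formal_eval big_map -sumrN; apply: eq_bigr => z _ /=.
have := lb z.2 (-1) z.1 0; rewrite /= addr0 scaleN1r => ->.
have := lb z.2 (-1) 0 0; rewrite /= scaler0 addr0 scaleN1r addNr => ->.
by rewrite addr0 scaleN1r.
Qed.

Lemma projective_norm_has_inf (s : formal_sum) :
  has_inf [set \sum_(z <- t) `|z.1| * `|z.2| | t in [set t | same_tensor s t]].
Proof.
split; first by exists (\sum_(z <- s) `|z.1| * `|z.2|), s.
by exists 0 => _ [u _ <-]; apply: sumr_ge0 => z _; rewrite mulr_ge0.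
Qed.

Lemma projective_norm_approx (s : formal_sum) e : 0 < e ->
  exists2 t, same_tensor s t & \sum_(z <- t) `|z.1| * `|z.2| < projective_norm
    s + e.
Proof.
move=> e0; have [_ [t st <-] tlt] :=
    @inf_adherent _ _ e e0 (projective_norm_has_inf s).
by exists t.
Qed.

Lemma projective_norm_ge0 (s : formal_sum) : 0 <= projective_norm s.
Proof.
apply: lb_le_inf; first by case: (projective_norm_has_inf s).
by move=> _ [u _ <-]; apply: sumr_ge0 => z _; rewrite mulr_ge0.
Qed.

(** Concatenating nearly optimal representations of [t] and of [s - t] gives a representation of
    [s]. *)
Lemma projective_norm_sub (s t : formal_sum) :
  projective_norm s <= projective_norm t + projective_norm (formal_sub s t).
Proof.
apply/ler_addgt0Pl => e e0; have e2 : 0 < e / 2 by rewrite divr_gt0.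
have [u tu ult] := projective_norm_approx t e2.
have [v stv vlt] := projective_norm_approx (formal_sub s t) e2.
have suv : same_tensor s (u ++ v).
  move=> W b; rewrite formal_eval_cat -tu -stv formal_eval_sub.
    by rewrite addrC subrK.
  by move=> y a x x'; rewrite linearPl.
apply: le_trans (projective_norm_le suv) _; rewrite big_cat /= [e]splitr.
by move: ult vlt; lra.
Qed.

Section Pairing.
Variables (S : bounded_operator X (dual Y)) (K : R).
Hypothesis K0 : 0 <= K.
Hypothesis SK : forall x y, `|S x y : R| <= K * `|x| * `|y|.

(** Equivalent formal sums have the same value, so the termwise estimate may be made on a nearly
    optimal representation. *)
Lemma formal_eval_le (s : formal_sum) : `|ev S s : R| <= K * projective_norm s.
Proof.
(* [same_tensor] quantifies over bundled bilinear maps, so [S] has to be packaged as one. *)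
have bil : exists b : {bilinear X -> Y -> R^o}, forall x y, b x y = S x y.
  pose b x y : R^o := S x y.
  have lb : bilinear_for *:%R *:%R b.
    by split=> [y a x x'|x a y y']; rewrite /b linearP.
  pose B := isBilinear.Build R X Y R^o *:%R *:%R b
    (fun y => zmod_morphism_linear (lb.1 y)) (fun x =>
      zmod_morphism_linear (lb.2 x))
    (fun y => scalable_linear (lb.1 y)) (fun x => scalable_linear (lb.2 x)).
  by exists (Bilinear.Pack (Bilinear.Class B)).
have [b bE] := bil.
have evE t : ev S t = formal_eval b t.
  by apply: eq_bigr => z _; rewrite bE.
have le t : same_tensor s t -> `|ev S s : R| <= K * \sum_(z <- t) `|z.1| *
  `|z.2|.
  move=> st; rewrite evE st -evE /formal_eval (le_trans (ler_norm_sum _ _ _))//.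
  by rewrite mulr_sumr; apply: ler_sum => z _; rewrite mulrA.
(* Dividing by [K + 1] rather than by [K] covers the case [K = 0]. *)
apply/ler_addgt0Pl => e e0; have K1 : 0 < K + 1 by rewrite ltr_wpDl.
have [t st tlt] := projective_norm_approx s (divr_gt0 e0 K1).
apply: (le_trans (le _ st)).
apply: (@le_trans _ _ (K * (projective_norm s + e / (K + 1)))).
  by rewrite ler_wpM2l// ltW.
have Ke : K * (e / (K + 1)) <= e.
  by rewrite mulrCA ler_piMr ?ltW// ltr_pdivrMr// mul1r ltrDl.
by rewrite mulrDr; lra.
Qed.

Lemma cauchy_seq_cvg (a : nat -> R) : (forall e, 0 < e ->
  exists N, forall m n, (N <= m)%N -> (N <= n)%N -> `|a m - a n| < e) ->
  cvg (a @ \oo).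
Proof.
move=> ha; apply/cauchy_cvgP/cauchy_exP => e /ha[N hN]; exists (a N).
by exists N => // n Nn; rewrite /ball /= hN.
Qed.

(** The reverse triangle inequality turns the Cauchy condition on [u] into one on the norms, so that
    the [limn] in [ptensor_norm] is a genuine limit. *)
Lemma ptensor_norm_cvg (u : projective_tensor X Y) :
  (fun n => projective_norm (u n)) @ \oo --> ptensor_norm u.
Proof.
apply: cauchy_seq_cvg => e e0; have [N hN] := ptensor_cauchy u e0.
exists N => m n Nm Nn; have mn := hN m n Nm Nn; have nm := hN n m Nn Nm.
have := projective_norm_sub (u m) (u n); have :=
  projective_norm_sub (u n) (u m).
by move=> h1 h2; rewrite ltr_norml; apply/andP; split; lra.
Qed.

Lemma ptensor_pairing_cvg (u : projective_tensor X Y) :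
  (fun n => ev S (u n) : R) @ \oo --> ptensor_pairing S u.
Proof.
apply: cauchy_seq_cvg => e e0; have K1 : 0 < K + 1 by rewrite ltr_wpDl.
have [N hN] := ptensor_cauchy u (divr_gt0 e0 K1).
exists N => m n Nm Nn; rewrite -formal_eval_sub; last first.
  by move=> y a x x'; rewrite linearP.
apply: le_lt_trans (formal_eval_le _) _.
apply: (@le_lt_trans _ _ ((K + 1) * projective_norm (formal_sub (u m) (u n)))).
  by rewrite ler_wpM2r ?projective_norm_ge0// lerDl.
by rewrite mulrC -ltr_pdivlMr// hN.
Qed.

Lemma ptensor_pairing_le (u : projective_tensor X Y) :
  `|ptensor_pairing S u| <= K * ptensor_norm u.
Proof.
have cK : (fun n => K * projective_norm (u n)) @ \oo --> K * ptensor_norm u.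
  by apply: cvgM; [exact: cvg_cst|exact: ptensor_norm_cvg].
have cS : (fun n => `|ev S (u n) : R|) @ \oo --> `|ptensor_pairing S u|.
  by apply: cvg_norm; exact: ptensor_pairing_cvg.
apply: (ler_cvg_to cS cK).
by apply: nearW => n; exact: formal_eval_le.
Qed.

End Pairing.

End ProjectiveTensorBounds.

(** * Multipliers *)

Lemma bounded_operatorB (R : realType) (V W : normedModType R)
  (f g : bounded_operator V W) x : (f - g) x = f x - g x.
Proof. by []. Qed.

(** * Almost everywhere statements and essential bounds *)

Section AlmostEverywhere.
Context d (Omega : measurableType d) (R : realType).
Variable mu : {measure set Omega -> \bar R}.

Lemma ae_countable (T : Type) (C : set T) (P : T -> Omega -> Prop) :
  countable C -> (forall c, C c -> \forall w \ae mu, P c w) ->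
  \forall w \ae mu, forall c, C c -> P c w.
Proof.
move=> /countable_injP[f injf] aeP.
have : \forall w \ae mu, forall n c, C c -> f c = n -> P c w.
  apply: ae_foralln => n.
  have [[c0 [Cc0 fc0]]|nc] := pselect (exists c, C c /\ f c = n); last first.
    by apply: aeW => w c Cc fc; case: nc; exists c.
  apply: filterS (aeP _ Cc0) => w Pw c Cc fc.
  by rewrite (injf c c0) ?inE// fc.
by apply: filterS => w Pw c Cc; exact: Pw Cc erefl.
Qed.

Lemma ae_eq_measurable_fun (f g : Omega -> R) : measure_is_complete mu ->
  (\forall w \ae mu, f w = g w) -> measurable_fun setT f ->
    measurable_fun setT g.
Proof.
move=> cmu fg /measurable_EFinP mf; apply/measurable_EFinP.
by apply: (ae_measurable_fun cmu _ mf); apply: filterS fg => w fgw _ /=;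
  rewrite fgw.
Qed.

(** On a space of total measure zero the norm is zero by convention; there both sides hold because
    [K] is nonnegative. *)
Lemma Lnorm_pinfty_leP (g : Omega -> R) (K : R) : 0 <= K ->
  (Lnorm mu +oo%E (fun w => (g w)%:E) <= K%:E)%E <->
  (\forall w \ae mu, `|g w| <= K).
Proof.
move=> K0; rewrite unlock /=; case: ifPn => [mu0|]; last first.
  rewrite lt0e measure_ge0 andbT negbK => /eqP mu0.
  by split=> [_|_]; [exact: measure0_ae|rewrite lee_fin].
by split=> [/ess_supP|h]; [|apply/ess_supP; move: h];
  apply: filterS => w /=; rewrite lee_fin.
Qed.

Lemma simple_tensor_scaled_norm (X Y : normedModType R) (x : X) (y : Y) :
  x != 0 -> y != 0 ->
  ptensor_norm (simple_tensor ((`|x| * `|y|)^-1 *: x) y) <= 1.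
Proof.
move=> x0 y0; apply: le_trans (ptensor_norm_simple_le _ _) _.
rewrite normrZ normfV normrM !normr_id -mulrA mulVf//.
by rewrite mulf_neq0 ?normr_eq0.
Qed.

(** * The sigma-star norm of operator-valued functions *)

Section MultiplierNorm.
Variables (X Y : normedModType R).
Local Notation L := (bounded_operator X (dual Y)).
Local Notation norm := (sigma_star_norm mu (@ptensor_norm R X Y)
  (@ptensor_pairing R X Y)).

(** The norm is tested on the simple tensor of [x] and [y], scaled into the unit ball. The
    exceptional null set depends on the pair. *)
Lemma sigma_star_norm_simple_ae (M : Omega -> L) (K : R) (x : X) (y : Y) :
  0 <= K -> (norm M <= K%:E)%E ->
  \forall w \ae mu, `|M w x y : R| <= K * `|x| * `|y|.
Proof.
move=> K0 MK; have [->|x0] := eqVneq x 0.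
  apply: aeW => w; rewrite (raddf0 (M w : {linear X -> dual Y})).
  by rewrite [X in `|X|]/(0 : R) !normr0 mulr0 mul0r.
have [->|y0] := eqVneq y 0.
  apply: aeW => w; rewrite (raddf0 (M w x : {linear Y -> R^o})).
  by rewrite !normr0 mulr0.
have xy0 : 0 < `|x| * `|y| by rewrite mulr_gt0 ?normr_gt0.
have : (Lnorm mu +oo%E (fun w =>
    (ptensor_pairing (M w) (simple_tensor ((`|x| * `|y|)^-1 *: x) y))%:E) <=
      K%:E)%E.
  apply: le_trans MK; apply: ereal_sup_ubound.
  by exists (simple_tensor ((`|x| * `|y|)^-1 *: x) y) => //=;
    exact: simple_tensor_scaled_norm.
move/(Lnorm_pinfty_leP _ K0); apply: filterS => w.
rewrite ptensor_pairing_simple linearZ [X in `|X|]/((`|x| * `|y|)^-1 * (M w x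
  y : R)).
by rewrite normrM normfV (gtr0_norm xy0) mulrC ler_pdivrMr// mulrA.
Qed.

Lemma sigma_star_bound (M : Omega -> L) :
  sigma_star mu (@ptensor_norm R X Y) (@ptensor_pairing R X Y) M ->
  exists2 K, 0 <= K &
    forall x y, \forall w \ae mu, `|M w x y : R| <= K * `|x| * `|y|.
Proof.
move=> [_ Mfin]; have [K K0 MK] : exists2 K : R, 0 <= K & (norm M <= K%:E)%E.
  case: (norm M) Mfin => [r||]// _.
    by exists (Num.max r 0); rewrite ?lee_fin le_max lexx ?orbT.
  by exists 0; [exact: lexx|exact: leNye].
by exists K => // x y; exact: sigma_star_norm_simple_ae.
Qed.

Lemma sigma_star_norm0_ae (M N : Omega -> L) x y :
  norm (fun w => M w - N w) = 0%E ->
  \forall w \ae mu, (M w x y : R) = N w x y.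
Proof.
move=> MN; have := @sigma_star_norm_simple_ae (fun w => M w - N w) 0 x y.
rewrite MN => /(_ (lexx _) (lexx _)); apply: filterS => w.
have -> : 0 * `|x| * `|y| = 0 :> R by rewrite !mul0r.
rewrite bounded_operatorB bounded_operatorB normr_le0 => /eqP h.
by apply/eqP; rewrite -subr_eq0; apply/eqP.
Qed.

Lemma sigma_star_measurable (M : Omega -> L) x y :
  sigma_star mu (@ptensor_norm R X Y) (@ptensor_pairing R X Y) M ->
  measurable_fun setT (fun w => M w x y : R).
Proof.
move=> [mM _]; have := mM (simple_tensor x y).
by under eq_fun do rewrite ptensor_pairing_simple.
Qed.

(** A bound valid at every [w] extends to all tensors by density, and makes the pairing a pointwise
    limit of finite sums of measurable functions. *)
Lemma sigma_star_uniformly_bounded (M : Omega -> L) (K : R) : 0 <= K ->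
  (forall x y, measurable_fun setT (fun w => M w x y : R)) ->
  (forall w x y, `|M w x y : R| <= K * `|x| * `|y|) ->
  sigma_star mu (@ptensor_norm R X Y) (@ptensor_pairing R X Y) M.
Proof.
move=> K0 mM MK; split=> [u|].
  apply: (@measurable_fun_cvg _ _ _ _ (fun n w => formal_eval (fun x y =>
    M w x y : R^o) (u n) : R)).
    move=> n; rewrite /formal_eval; apply: measurable_sum => z; exact: mM.
  by move=> w _; exact: (ptensor_pairing_cvg K0 (MK w)).
apply: (@le_lt_trans _ _ K%:E); last exact: ltry.
apply: ge_ereal_sup => _ [u /= u1 <-]; apply/Lnorm_pinfty_leP => //.
apply: aeW => w; apply: le_trans (ptensor_pairing_le K0 (MK w) u) _.
by rewrite ler_piMr.
Qed.

(** A tensor is a sequence of finite sums, so it involves only countably many pairs [x], [y], whose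
    null sets can be united. *)
Lemma sigma_star_norm_ae_eq (M N : Omega -> L) :
  (forall x y, \forall w \ae mu, (M w x y : R) = N w x y) ->
  norm (fun w => M w - N w) = 0%E.
Proof.
move=> MN; apply/eqP; rewrite eq_le; apply/andP; split; last first.
  (* The tensor of [0] and [0] shows that the supremum is over a nonempty set, hence nonnegative. *)
  apply: (@le_trans _ _ (Lnorm mu +oo%E (fun w =>
    (ptensor_pairing (M w - N w) (simple_tensor 0 0))%:E))).
    exact: Lnorm_ge0.
  apply: ereal_sup_ubound; exists (simple_tensor 0 0) => //=.
  by apply: le_trans (ptensor_norm_simple_le _ _) _; rewrite normr0 mul0r.
apply: ge_ereal_sup => _ [u /= _ <-]; apply/Lnorm_pinfty_leP => //.
have : \forall w \ae mu, forall n, formal_eval (fun x y =>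
  (M w - N w) x y : R^o) (u n) = 0.
  apply: ae_foralln => n; rewrite /formal_eval; elim: (u n) => [|z s IH].
    by apply: aeW => w; rewrite big_nil.
  apply: filterS2 IH (MN z.1 z.2) => w sw zw; rewrite big_cons sw addr0.
  by rewrite bounded_operatorB bounded_operatorB zw subrr.
apply: filterS => w uw; rewrite (_ : ptensor_pairing _ _ = 0) ?normr0//.
rewrite /ptensor_pairing; under eq_fun do rewrite uw.
by apply: cvg_lim => //; exact: cvg_cst.
Qed.

End MultiplierNorm.
End AlmostEverywhere.

(** * Positive representatives from ultralimits *)

Section UltralimitMultiplier.
Context d (Omega : measurableType d) (R : realType).
Variable mu : {measure set Omega -> \bar R}.

(** For rational [q], the set where [f >= q] belongs to [U w] for almost all of its points [w], and
    then [g w >= q]; likewise for [f <= q]. Outside countably many null sets no rational separates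
    [f w] from [g w]. *)
Lemma ultralimit_ae_eq (N : set Omega) (U : Omega -> set_system Omega)
    (f g : Omega -> R) :
  mu.-negligible N -> (forall w, ~ N w -> UltraFilter (U w)) ->
  (forall E, measurable E -> mu.-negligible (E `\` [set w | U w E])) ->
  measurable_fun setT f -> (forall w, ~ N w -> f @ U w --> g w) ->
  \forall w \ae mu, g w = f w.
Proof.
move=> negN UU Udense mf fg.
have nN : \forall w \ae mu, ~ N w by apply: negligibleS negN => w /= /contrapT.
have Uae (I : interval R) : \forall w \ae mu, f w \in I ->
  U w [set t | f t \in I].
  have mE : measurable (f @^-1` [set` I]).
    by rewrite -[X in measurable X]setTI; exact: mf.
  by apply: negligibleS (Udense _ mE) => w /= /not_implyP[].
have /ae_countable-/(_ (countableP _)) aeL := fun (q : rat) (_ : setT q) =>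
  Uae `[ratr q, +oo[.
have /ae_countable-/(_ (countableP _)) aeR := fun (q : rat) (_ : setT q) =>
  Uae `]-oo, ratr q].
apply: filterS3 nN aeL aeR => w nNw wL wR; have UUw := UU w nNw.
apply/eqP; rewrite eq_le; apply/andP; split; rewrite leNgt; apply/negP =>
  /rat_in_itvoo[q];
  rewrite in_itv/= => /andP[lq qr].
- suff : g w <= ratr q by rewrite leNgt qr.
  apply: (cvgr_to_le (fg w nNw)); have := wR q I; rewrite in_itv/= =>
    /(_ (ltW lq)).
  by apply: filterS => t /=; rewrite in_itv.
- suff : ratr q <= g w by rewrite leNgt lq.
  apply: (cvgr_to_ge (fg w nNw)); have := wL q I; rewrite in_itv/= andbT =>
    /(_ (ltW qr)).
  by apply: filterS => t /=; rewrite in_itv/= andbT.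
Qed.

(** Conull sets belong to every [U w] with [w] outside [N], so bounds and signs valid almost
    everywhere pass to the limit at each such [w]. On [N] the value is [0]. *)
Lemma exists_positive_representative (X Y : normedModType R)
    (M : Omega -> bounded_operator X (dual Y)) (K : R) :
  measure_is_complete mu -> strictly_localizable mu -> 0 <= K ->
  (forall x y, measurable_fun setT (fun w => M w x y : R)) ->
  (forall x y, \forall w \ae mu, `|M w x y : R| <= K * `|x| * `|y|) ->
  exists M1 : Omega -> bounded_operator X (dual Y),
  [/\ forall w x y, `|M1 w x y : R| <= K * `|x| * `|y|,
      forall x y, \forall w \ae mu, (M1 w x y : R) = M w x y &
      forall x y, (\forall w \ae mu, 0 <= (M w x y : R)) ->
        forall w, 0 <= (M1 w x y : R)].
Proof.
move=> cmu lmu K0 mM MK.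
have [N [U [negN UU Uae Udense]]] := exists_density_ultrafilters cmu lmu.
have /choice[M1 M1P] : forall w, exists S : bounded_operator X (dual Y),
    (N w -> S = 0) /\
    (~ N w -> forall x y, (fun t => M t x y : R) @ U w --> (S x y : R)).
  move=> w; have [Nw|nNw] := pselect (N w); first by exists 0.
  have UUw := UU w nNw.
  have [|S SP] := @exists_ultralimit_operator R Omega (U w) X Y M K _ K0;
    last by exists S.
  by move=> x y; apply: Uae => //; exact: MK.
exists M1; split.
- move=> w x y; have [Nw|nNw] := pselect (N w).
    rewrite (M1P w).1// [X in `|X|]/(0 : R) normr0.
    by rewrite !mulr_ge0.
  have UUw := UU w nNw.
  have cM : (fun t => `|M t x y : R|) @ U w --> `|M1 w x y : R|.
    by apply: cvg_norm; exact: (M1P w).2.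
  by apply: (cvgr_to_le cM); apply: Uae => //; exact: MK.
- move=> x y; apply: (ultralimit_ae_eq negN UU Udense (mM x y)) => w nNw.
  exact: (M1P w).2.
- move=> x y M0 w; have [Nw|nNw] := pselect (N w).
    by rewrite (M1P w).1.
  have UUw := UU w nNw.
  by apply: (cvgr_to_ge ((M1P w).2 nNw x y)); apply: Uae.
Qed.

End UltralimitMultiplier.

(** * Almost separably valued functions and test functions *)

Section StronglyMeasurable.
Context d (Omega : measurableType d) (R : realType).
Variable mu : {measure set Omega -> \bar R}.

Lemma strongly_measurable_separable (V : normedModType R) (f : Omega -> V) :
  strongly_measurable mu f -> exists2 C : set V, countable C &
    \forall w \ae mu, forall e, 0 < e -> exists2 c, C c & `|f w - c| < e.
Proof.
move=> [_ [N negN [C [cC _ fC]]]]; exists C => //.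
apply: negligibleS negN => w; apply: contra_notP => nNw e e0.
have /(_ _ (nbhsx_ballx (f w) e e0))[c [Cc]] : closure C (f w).
  by apply: fC; exists w.
by rewrite -ball_normE /= => fc; exists c.
Qed.

(** The null set in the hypothesis depends on [x]; a countable set approximating almost all values
    of [f] leaves one null set, and continuity of the difference of the operators concludes. *)
Lemma operator_ae_eq_apply (X Y : normedModType R)
    (M N : Omega -> bounded_operator X (dual Y)) (f : Omega -> X) (y : Y) :
  (forall x, \forall w \ae mu, (M w x y : R) = N w x y) ->
  strongly_measurable mu f ->
  \forall w \ae mu, (M w (f w) y : R) = N w (f w) y.
Proof.
move=> MN /strongly_measurable_separable[C cC fC].
have := ae_countable cC (fun c _ => MN c); apply: filterS2 fC => w fw MNw.
pose D := M w - N w; have DE x : (D x y : R) = (M w x y : R) - N w x y.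
  by rewrite /D bounded_operatorB bounded_operatorB.
clearbody D.
suff : `|D (f w) y : R| <= 0 by rewrite normr_le0 DE subr_eq0 => /eqP.
apply/ler_addgt0Pl => e e0; rewrite addr0.
have k0 : 0 < `|D| * `|y| + 1 by rewrite ltr_wpDl// mulr_ge0.
have [c Cc fc] := fw _ (divr_gt0 e0 k0).
have -> : (D (f w) y : R) = D (f w - c) y.
  have Dc : (D c y : R) = 0 by rewrite DE MNw// subrr.
  have Dfc : D (f w - c) = D (f w) - D c by exact: linearB.
  by rewrite Dfc bounded_operatorB Dc; exact/esym/subr0.
apply: (le_trans (operator_norm_scale _ _)).
apply: (@le_trans _ _ (`|D| * `|f w - c| * `|y|)).
  by rewrite ler_wpM2r// operator_norm_scale.
rewrite mulrAC; apply: (@le_trans _ _ ((`|D| * `|y| + 1) * `|f w - c|)).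
  by rewrite ler_wpM2r// lerDl.
by rewrite mulrC -ler_pdivlMr// ltW.
Qed.

(** [F] is not assumed separable, so the countably many test vectors come from the separability of
    the values of [g]. *)
Lemma dual_positive_ae (F : banachLattice R) (g : Omega -> dual F) :
  strongly_measurable mu g ->
  (forall v, bl_le 0 v -> \forall w \ae mu, 0 <= (g w v : R)) ->
  \forall w \ae mu, dual_positive (g w).
Proof.
move=> /strongly_measurable_separable[C cC gC] gpos.
(* [z (c, n)] separates the ball of centre [c] and radius [1 / (n + 1)] from the
   positive cone whenever a single vector can; as the centres form a countable
   dense set, these witnesses suffice. *)
pose bad (c : dual F) (n : nat) (v : F) := bl_le 0 v /\
  forall x' : dual F, `|x' - c| < n.+1%:R^-1 -> (x' v : R) < 0.
have /choice[z zP] : forall cn : dual F * nat, exists v,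
    bl_le 0 v /\ ((exists v', bad cn.1 cn.2 v') -> bad cn.1 cn.2 v).
  move=> [c n]; have [[v bv]|nb] := pselect (exists v, bad c n v).
    by exists v; split=> //; case: bv.
  by exists 0; split=> //; exact: bl_le_refl.
have : \forall w \ae mu, forall n c, C c -> 0 <= (g w (z (c, n)) : R).
  apply: ae_foralln => n; apply: ae_countable => // c _.
  by apply: gpos; case: (zP (c, n)).
apply: filterS2 gC => w gw zw v v0; rewrite leNgt; apply/negP => gv0.
have k0 : 0 < `|v| + 1 by rewrite ltr_wpDl.
have e0 : 0 < - (g w v : R) / (`|v| + 1) by rewrite divr_gt0// oppr_gt0.
(* A functional within [1 / (n + 1)] of [c] is within [2 / (n + 1)] of [g w]; this [n] makes that
   distance too small to undo the negative sign at [v]. *)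
pose n := Num.truncn (2 / (- (g w v : R) / (`|v| + 1))).
have n0 : 0 < n.+1%:R^-1 :> R by rewrite invr_gt0.
have [c Cc gc] := gw _ n0.
have cg : `|c - g w| < n.+1%:R^-1 by rewrite -normrN opprB.
have [_ [|_ zneg]] := zP (c, n).
  exists v; split=> //= x' x'c.
  have x'g : `|x' - g w| < 2 * n.+1%:R^-1.
    rewrite mulr_natl mulr2n; apply: le_lt_trans (ler_distD c x' (g w)) _.
    by apply: ltrD; first exact: x'c; exact: cg.
  have : (x' v : R) - g w v <= `|x' - g w| * `|v|.
    have := operator_norm_scale (x' - g w) v; rewrite bounded_operatorB.
    exact: le_trans (ler_norm _).
  move=> h; rewrite -[X in X < _](subrK (g w v : R)) -ltrBrDr sub0r.
  apply: (le_lt_trans h); apply: (@le_lt_trans _ _ (`|x' - g w| * (`|v| + 1))).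
    by rewrite ler_wpM2l// lerDl.
  rewrite -ltr_pdivlMr//; apply: (lt_le_trans x'g).
  rewrite ler_pdivrMr// -ler_pdivrMl// mulrC.
  exact/ltW/truncnS_gt.
have := zw n c Cc; rewrite leNgt => /negP; apply; exact: zneg.
Qed.

(** Constant functions may fail to be in the Bochner space when [mu] is infinite; their restrictions
    to sets of finite measure replace them as test functions. *)
Lemma exists_indicator_Lp (V : normedModType R) (p : \bar R) (A : set Omega)
    (x : V) : (1 <= p)%E -> measurable A -> (mu A < +oo)%E ->
  exists f : bochnerLp mu V p, forall w, f w = \1_A w *: x.
Proof.
move=> p1 mA Afin; pose f w := \1_A w *: x : V.
have f_meas : strongly_measurable mu f.
  split.
    move=> phi; rewrite (_ : (fun w => _) = fun w =>
      (\1_A w : R) * (phi x : R)).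
      by apply: measurable_funM => //; exact: measurable_indic.
    by apply/funext => w; rewrite linearZ.
  exists set0; first exact: negligible_set0.
  exists (f @` (~` set0)); split=> //; last exact: subset_closure.
  apply: finite_set_countable; apply: (@sub_finite_set _ _ [set 0; x]) => //.
  move=> _ [w _ <-]; rewrite /f indicE; case: (w \in A); [right|left].
    by rewrite scale1r.
  by rewrite scale0r.
have f_fin : (bochner_norm mu p f < +oo)%E.
  rewrite /bochner_norm; case: p p1 => [r||]//; last first.
    move=> _; apply: (@le_lt_trans _ _ `|x|%:E); last exact: ltry.
    apply/Lnorm_pinfty_leP => //; apply: aeW => w;
      rewrite normr_id normrZ indicE.
    by case: (w \in A); rewrite ?normr1 ?mul1r ?normr0 ?mul0r.
  rewrite lee_fin => r1; have r0 : r != 0 by rewrite gt_eqF// (lt_le_trans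
    ltr01).
  rewrite unlock /=; apply: poweR_lty.
  rewrite (_ : (fun w => _) = (cst (`|x| `^ r)%:E) \_ A).
    rewrite -integral_mkcond integral_cst//.
    by rewrite lte_mul_pinfty.
  apply/funext => w; rewrite patchE /f indicE normrZ; case: (w \in A).
    by rewrite normr1 mul1r normr_id.
  by rewrite normr0 mul0r normr0 /= powR0.
by exists (BochnerLp f_meas f_fin).
Qed.

End StronglyMeasurable.

(** * Positivity of local operators and of their multipliers *)

Theorem theorem5p2 (R : realType) (d : measure_display)
    (Omega : measurableType d) (mu : {measure set Omega -> \bar R})
    (p : \bar R) (F : banachLattice R)
    (T : bochnerLp mu (dual F) p -> bochnerLp mu (dual F) p)
    (M : Omega -> bounded_operator (dual F) (dual F)) :
  measure_is_complete mu ->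
  strictly_localizable mu ->
  (1 <= p)%E ->
  bounded_Lp_operator T ->
  local_operator T ->
  multiplier mu M ->
  is_multiplication_by T M ->
  positive_Lp_operator T <-> positive_multiplier mu M.
Proof.
move=> cmu lmu p1 _ _ mM [M0 [mM0 M0M] TE]; split=> [Tpos|[M1 [mM1 M1M] M1pos]].
- have [K K0 M0K] := sigma_star_bound mM0.
  have M0meas x v := sigma_star_measurable x v mM0.
  have [M1 [M1K M1M0 M1ge0]] := exists_positive_representative cmu lmu K0 M0meas M0K.
  exists M1.
    split.
      apply: sigma_star_uniformly_bounded K0 _ M1K => x v.
      by apply: (ae_eq_measurable_fun cmu _ (M0meas x v)); apply: filterS (M1M0 x v).
    apply: sigma_star_norm_ae_eq => x v.
    have := sigma_star_norm0_ae x v M0M.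
    by apply: filterS2 (M1M0 x v) => w -> ->.
  move=> w x' x'pos v v0; apply: M1ge0.
  (* The sign of [M0 t x' v] is tested on each piece, by applying [T] to the indicator of the piece
     times [x']. *)
  have [I [A [mA _ _ negA]]] := localizable_pieces cmu lmu.
  apply: negA => i; have [mAi Afin] := mA i.
  have [f fE] := exists_indicator_Lp x' p1 mAi Afin.
  have fpos : Lp_positive f.
    apply: aeW => t u u0; rewrite fE indicE; case: (t \in A i).
      by rewrite scale1r; exact: x'pos.
    by rewrite scale0r.
  have : \forall t \ae mu, A i t -> 0 <= (M0 t x' v : R).
    apply: filterS2 (TE f) (Tpos f fpos) => t Tft Tpost Ait.
    by have := Tpost v v0; rewrite Tft fE indicE mem_set// scale1r.
  by apply: negligibleS => t [nM0 Ait] /= /(_ Ait).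
- move=> f fpos; apply: dual_positive_ae (Lp_strongly_measurable (T f)) _ => v v0.
  (* [M0] and [M1] both represent [M], so for fixed [x'] and [v] they agree almost everywhere;
     strong measurability of [f] then allows [f w] in place of the constant [x']. *)
  have M01 x' : \forall w \ae mu, (M0 w x' v : R) = M1 w x' v.
    apply: filterS2 (sigma_star_norm0_ae x' v M0M) (sigma_star_norm0_ae x' v M1M).
    by move=> w -> ->.
  have M01f := operator_ae_eq_apply M01 (Lp_strongly_measurable f).
  apply: filterS3 (TE f) M01f fpos => w -> -> fw.
  exact: M1pos.
Qed.
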